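(* Consider the system and notation described in the context, and assume $0<a_1<\sqrt{4d_1r}$, $L>L_1^*$ and $x_1<L^*$. Then: (i) Fix all parameters except $a_2$ and $h$. There exist $h^{**}>0$ and a function $a_2^*(h)$, strictly increasing in $h\in[h^{**},\infty)$, such that $(0,\tilde w)$ is unstable for $(a_2,h)\in\{a_2\ge0,\ h<h^{**}\}\cup\{a_2>a_2^*(h),\ h>h^{**}\}$ and linearly stable for $(a_2,h)\in\{0\le a_2<a_2^*(h),\ h>h^{**}\}$. (ii) Fix all parameters except $a_2$ and $q$. There exist $q^{**}>0$ and a function $\bar a_2(q)$, strictly decreasing in $q\in[0,q^{**}]$, such that $(0,\tilde w)$ is unstable for $(a_2,q)\in\{a_2\ge0,\ q>q^{**}\}\cup\{a_2>\bar a_2(q),\ 0<q<q^{**}\}$ and linearly stable for $(a_2,q)\in\{0\le a_2<\bar a_2(q),\ 0<q<q^{**}\}$. (iii) Fix all parameters except $a_2$ and $m$. There exist $m^{**}>0$ and a function $\hat a_2(m)$, strictly increasing in $m\in[m^{**},\infty)$, such that $(0,\tilde w)$ is unstable for $(a_2,m)\in\{a_2\ge0,\ m<m^{**}\}\cup\{a_2>\hat a_2(m),\ m>m^{**}\}$ and linearly stable for $(a_2,m)\in\{0\le a_2<\hat a_2(m),\ m>m^{**}\}$. (iv) Fix all parameters except $h$ and $m$. There exists a function $\hat h(m)$, strictly decreasing in $m>0$, such that $(0,\tilde w)$ is unstable for $\{0<h<\hat h(m),\ m>0\}$ and linearly stable for $\{h>\hat h(m),\ m>0\}$. (v) Fix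 all parameters except $q$ and $m$. There exists a function $\hat q(m)$, strictly increasing in $m>0$, such that $(0,\tilde w)$ is unstable for $\{q>\hat q(m),\ m>0\}$ and linearly stable for $\{0<q<\hat q(m),\ m>0\}$.
   Context: Let $d_1,d_2,r,m,p,q,h,L>0$, $a_1>0$, $a_2\ge0$ and $0\le x_1<L$. Let $\chi_{(x_1,L]}(x)=1$ for $x_1<x\le L$ and $0$ for $0\le x\le x_1$. Consider the system $u_t=d_1u_{xx}-a_1u_x+u(r-u-m\chi_{(x_1,L]}w)$, $x\in(0,L)$; $w_t=d_2w_{xx}-a_2w_x+h-qw-puw$, $x\in(x_1,L)$; $d_1u_x(0,t)-a_1u(0,t)=u_x(L,t)=0$, $d_2w_x(x_1,t)-a_2w(x_1,t)=w_x(L,t)=0$; nonnegative nontrivial initial data. Let $\tilde w$ be the unique positive solution of $d_2w''-a_2w'+h-qw=0$ on $(x_1,L)$, $d_2w'(x_1)-a_2w(x_1)=w'(L)=0$ (it depends on $a_2,h,q$). For $0\le y_1<y_2\le L$, $d>0$, $a\ge0$, bounded $s$, $\lambda_1(d,a,s,(y_1,y_2))$ is the principal eigenvalue of $d\varphi''-a\varphi'+s\varphi=\lambda\varphi$ on $(y_1,y_2)$, $d\varphi'(y_1)-a\varphi(y_1)=\varphi'(y_2)=0$. The semi-trivial state $(0,\tilde w)$ is linearly stable if $\lambda_1(d_1,a_1,r-m\chi_{(x_1,L]}\tilde w,(0,L))<0$ and unstable if it is $>0$. For $0<a_1<\sqrt{4d_1r}$: $L^*=2d_1\big(\pi-\arctan\frac{\sqrt{4d_1r-a_1^2}}{a_1}\big)/\sqrt{4d_1r-a_1^2}$;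 $L_1^*=2d_1\arctan\big(\frac{a_1\sqrt{4d_1r-a_1^2}}{2d_1r-a_1^2}\big)/\sqrt{4d_1r-a_1^2}$ if $a_1\le\sqrt{2d_1r}$ and $L_1^*=2d_1\big(\pi+\arctan\frac{a_1\sqrt{4d_1r-a_1^2}}{2d_1r-a_1^2}\big)/\sqrt{4d_1r-a_1^2}$ if $\sqrt{2d_1r}<a_1<\sqrt{4d_1r}$. *)

(* Defs.v *)
From Stdlib Require Import Reals Lra.
From Coquelicot Require Import Coquelicot.
Open Scope R_scope.

Definition chi (x1 L x : R) : R :=
  if Rlt_dec x1 x then (if Rle_dec x L then 1 else 0) else 0.

Definition wtilde_sol (d2 a2 h q x1 L : R) (w : R -> R) : Prop :=
  (forall x, x1 <= x <= L -> ex_derive w x /\ ex_derive (Derive w) x) /\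
  (forall x, x1 <= x <= L ->
      d2 * Derive (Derive w) x - a2 * Derive w x + h - q * w x = 0) /\
  d2 * Derive w x1 - a2 * w x1 = 0 /\
  Derive w L = 0 /\
  (forall x, x1 <= x <= L -> 0 < w x).

(* (lam, phi) is a principal eigenpair of
     d phi'' - a phi' + s phi = lam phi on (y1,y2),
     d phi'(y1) - a phi(y1) = 0,  phi'(y2) = 0,
   with phi > 0 on [y1,y2].  Since s may be discontinuous (bounded, piecewise
   continuous), the equation is taken in integrated (Caratheodory) form:
     (d phi' - a phi)(x) = int_{y1}^x (lam - s) phi,
   which at x = y1 also encodes the left boundary condition. *)
Definition principal_eigenpair (d a : R) (s : R -> R) (y1 y2 lam : R)
    (phi : R -> R) : Prop :=
  (forall x, y1 <= x <= y2 -> 0 < phi x) /\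
  (forall x, y1 <= x <= y2 -> ex_derive phi x) /\
  (forall x, y1 <= x <= y2 ->
      ex_RInt (fun t => (lam - s t) * phi t) y1 x /\
      d * Derive phi x - a * phi x = RInt (fun t => (lam - s t) * phi t) y1 x) /\
  Derive phi y2 = 0.

(* lam = lambda_1(d,a,s,(y1,y2)): the (unique) eigenvalue with a positive eigenfunction *)
Definition is_lambda1 (d a : R) (s : R -> R) (y1 y2 lam : R) : Prop :=
  exists phi, principal_eigenpair d a s y1 y2 lam phi.

Definition pot (r m x1 L : R) (w : R -> R) (x : R) : R := r - m * chi x1 L x * w x.

Definition lin_stable (d1 d2 r m q h a1 a2 x1 L : R) : Prop :=
  exists w, wtilde_sol d2 a2 h q x1 L w /\
    exists lam, is_lambda1 d1 a1 (pot r m x1 L w) 0 L lam /\ lam < 0.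

Definition unstable (d1 d2 r m q h a1 a2 x1 L : R) : Prop :=
  exists w, wtilde_sol d2 a2 h q x1 L w /\
    exists lam, is_lambda1 d1 a1 (pot r m x1 L w) 0 L lam /\ 0 < lam.

Definition Lstar (d1 r a1 : R) : R :=
  2 * d1 * (PI - atan (sqrt (4 * d1 * r - a1 ^ 2) / a1)) / sqrt (4 * d1 * r - a1 ^ 2).

(* at a1 = sqrt(2 d1 r) the arctan argument is +infinity; we use the limit value PI/2 *)
Definition L1star (d1 r a1 : R) : R :=
  let D := sqrt (4 * d1 * r - a1 ^ 2) in
  let t := atan (a1 * D / (2 * d1 * r - a1 ^ 2)) in
  match total_order_T a1 (sqrt (2 * d1 * r)) with
  | inleft (left _) => 2 * d1 * t / D
  | inleft (right _) => 2 * d1 * (PI / 2) / D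
  | inright _ => 2 * d1 * (PI + t) / D
  end.

Definition strict_incr_on (P : R -> Prop) (f : R -> R) : Prop :=
  forall x y, P x -> P y -> x < y -> f x < f y.
Definition strict_decr_on (P : R -> Prop) (f : R -> R) : Prop :=
  forall x y, P x -> P y -> x < y -> f y < f x.

(* Main.v *)
(* The logarithmic derivative y = phi'/phi of a positive eigenfunction solves the Riccati
   equation y' = -y^2 + (a1/d1) y + (lam - s)/d1 with y(0) = a1/d1 and y(L) = 0. The eigenvalue
   is found by shooting in lam for the equation with a truncated quadratic term. Comparing two
   Riccati solutions with an integrating factor shows that the eigenvalue is strictly
   decreasing and 1-Lipschitz in the toxin profile. Explicit comparison solutions built from
   tangents show that it is positive for small profiles when L > L1* and negative for large
   ones when x1 < L*.

   The steady state is h W(a2, q), so the potential depends on m and h only through m h, and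
   there is a critical value F(a2, q) of m h at which the eigenvalue changes sign. The maximum
   principle shows that W is strictly decreasing in a2 and in q, that it varies continuously,
   and that it tends to 0 as a2 or q tends to infinity; hence F is continuous, strictly
   increasing and unbounded in each variable. The curves of the five statements are level sets
   of F, and their monotonicity is that of F. *)
Require Import Defs.
From Stdlib Require Import Reals Psatz ClassicalEpsilon.
From Coquelicot Require Import Coquelicot.
Open Scope R_scope.

(** * Calculus and Picard iteration *)

Lemma lipschitz_continuous (f : R -> R) (K : R) :
  (forall x y, Rabs (f x - f y) <= K * Rabs (x - y)) -> forall x, continuous f x.
Proof.
  intros H x. apply continuity_pt_filterlim.
  assert (HK : 0 < Rabs K + 1) by (pose proof (Rabs_pos K); lra).
  intros e He. exists (e / (Rabs K + 1)). split.
  { apply Rdiv_lt_0_compat; lra. }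
  intros y [_ Hy]. simpl in Hy |- *. unfold R_dist in *.
  apply Rle_lt_trans with (1 := H y x).
  apply Rle_lt_trans with ((Rabs K + 1) * Rabs (y - x)).
  { apply Rmult_le_compat_r; [apply Rabs_pos|]. pose proof (Rle_abs K); lra. }
  apply Rmult_lt_compat_l with (r := Rabs K + 1) in Hy; [|exact HK].
  replace ((Rabs K + 1) * (e / (Rabs K + 1))) with e in Hy by (field; lra). exact Hy.
Qed.

Lemma derive_nonneg_le (f l : R -> R) (u v : R) :
  u <= v -> (forall x, continuous f x) ->
  (forall x, u < x < v -> is_derive f x (l x)) ->
  (forall x, u < x < v -> 0 <= l x) -> f u <= f v.
Proof.
  intros Huv Hc Hd Hl.
  destruct (MVT_gen f u v (fun x => if Rlt_dec u x then if Rlt_dec x v then l x else 0 else 0))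
    as [c [_ Hc']].
  - rewrite Rmin_left, Rmax_right by lra. intros x Hx.
    destruct (Rlt_dec u x); [|lra]. destruct (Rlt_dec x v); [|lra]. apply Hd; lra.
  - intros x _. apply continuity_pt_filterlim, Hc.
  - enough (0 <= f v - f u) by lra. rewrite Hc'. apply Rmult_le_pos; [|lra].
    destruct (Rlt_dec u c); [|lra]. destruct (Rlt_dec c v); [|lra]. apply Hl; lra.
Qed.

Lemma derive_pos_lt (f l : R -> R) (u v : R) :
  u < v -> (forall x, continuous f x) ->
  (forall x, u < x < v -> is_derive f x (l x)) ->
  (forall x, u < x < v -> 0 < l x) -> f u < f v.
Proof.
  intros Huv Hc Hd Hl.
  destruct (MVT_gen f u v (fun x => if Rlt_dec u x then if Rlt_dec x v then l x else 1 else 1))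
    as [c [_ Hc']].
  - rewrite Rmin_left, Rmax_right by lra. intros x Hx.
    destruct (Rlt_dec u x); [|lra]. destruct (Rlt_dec x v); [|lra]. apply Hd; lra.
  - intros x _. apply continuity_pt_filterlim, Hc.
  - enough (0 < f v - f u) by lra. rewrite Hc'. apply Rmult_lt_0_compat; [|lra].
    destruct (Rlt_dec u c); [|lra]. destruct (Rlt_dec c v); [|lra]. apply Hl; lra.
Qed.

Lemma continuous_ex_RInt (f : R -> R) (u v : R) :
  (forall x, continuous f x) -> ex_RInt f u v.
Proof. intros H. apply (ex_RInt_continuous (V := R_CompleteNormedModule)). intros; apply H. Qed.

Lemma is_derive_primitive (f : R -> R) (u x : R) :
  (forall y, continuous f y) -> is_derive (fun y => RInt f u y) x (f x).
Proof.
  intros H. apply (is_derive_RInt (V := R_NormedModule) f (fun y => RInt f u y) u).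
  - apply filter_forall. intros y. apply (RInt_correct (V := R_CompleteNormedModule)).
    apply continuous_ex_RInt, H.
  - apply H.
Qed.

Lemma continuous_primitive (f : R -> R) (u x : R) :
  (forall y, continuous f y) -> continuous (fun y => RInt f u y) x.
Proof.
  intros H. apply (ex_derive_continuous (fun y => RInt f u y)).
  exists (f x). apply is_derive_primitive, H.
Qed.

Lemma is_RInt_open_derive (F f : R -> R) (u v : R) :
  u <= v -> (forall x, continuous F x) -> (forall x, continuous f x) ->
  (forall x, u < x < v -> is_derive F x (f x)) -> is_RInt f u v (F v - F u).
Proof.
  intros Huv HF Hf Hd.
  assert (Hz : forall x, u < x < v ->
            is_derive (fun x => F x - RInt f u x) x (f x - f x)).
  { intros x Hx. apply (is_derive_minus F (fun x => RInt f u x)).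
    - apply Hd, Hx.
    - apply is_derive_primitive, Hf. }
  assert (Hcz : forall x, continuous (fun x => F x - RInt f u x) x).
  { intros x. apply (continuous_minus F (fun x => RInt f u x)).
    - apply HF.
    - apply continuous_primitive, Hf. }
  assert (H1 : F u - RInt f u u <= F v - RInt f u v).
  { apply (derive_nonneg_le (fun x => F x - RInt f u x) (fun x => f x - f x) u v); auto.
    intros; lra. }
  assert (H2 : - (F u - RInt f u u) <= - (F v - RInt f u v)).
  { apply (derive_nonneg_le (fun x => - (F x - RInt f u x)) (fun x => - (f x - f x)) u v); auto.
    - intros x. apply (continuous_opp (fun x => F x - RInt f u x)), Hcz.
    - intros x Hx. apply (is_derive_opp (fun x => F x - RInt f u x)), Hz, Hx.
    - intros; lra. }
  rewrite (RInt_point (V := R_CompleteNormedModule)) in H1, H2.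
  change (@zero R_CompleteNormedModule) with 0 in H1, H2.
  replace (F v - F u) with (RInt f u v) by lra.
  apply (RInt_correct (V := R_CompleteNormedModule)), continuous_ex_RInt, Hf.
Qed.

Lemma RInt_abs_le (f g : R -> R) (u v : R) :
  u <= v -> (forall x, continuous f x) -> (forall x, continuous g x) ->
  (forall x, u < x < v -> Rabs (f x) <= g x) -> Rabs (RInt f u v) <= RInt g u v.
Proof.
  intros Huv Hf Hg H.
  apply Rabs_le. split.
  - rewrite <- (RInt_opp (V := R_CompleteNormedModule)) by (apply continuous_ex_RInt, Hg).
    apply RInt_le; [exact Huv| | |].
    + apply continuous_ex_RInt. intros x. apply (continuous_opp g), Hg.
    + apply continuous_ex_RInt, Hf.
    + intros x Hx. specialize (H x Hx). apply Rabs_le_between in H. apply H.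
  - apply RInt_le; [exact Huv| | |].
    + apply continuous_ex_RInt, Hf.
    + apply continuous_ex_RInt, Hg.
    + intros x Hx. specialize (H x Hx). apply Rabs_le_between in H. apply H.
Qed.

Fixpoint picard_iter (g Phi : R -> R) (n : nat) (x : R) : R :=
  match n with
  | O => 0
  | S n => RInt (fun t => g (picard_iter g Phi n t + Phi t)) 0 x
  end.

Lemma picard_iter_continuous (g Phi : R -> R) (n : nat) :
  (forall x, continuous g x) -> (forall x, continuous Phi x) ->
  forall x, continuous (picard_iter g Phi n) x.
Proof.
  intros Hg HP. induction n as [|n IH]; intros x; simpl.
  - apply continuous_const.
  - apply continuous_primitive. intros y.
    apply (continuous_comp (fun t => picard_iter g Phi n t + Phi t) g); [|apply Hg].
    apply (continuous_plus (picard_iter g Phi n) Phi); auto.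
Qed.

Lemma continuous_exp_lin (A k x : R) : continuous (fun t => A * exp (k * t)) x.
Proof.
  apply (ex_derive_continuous (fun t => A * exp (k * t))). auto_derive. exact I.
Qed.

Lemma RInt_exp_lin (A K x : R) :
  0 < K -> RInt (fun t => K * A * exp (2 * K * t)) 0 x = A / 2 * (exp (2 * K * x) - 1).
Proof.
  intros HK. apply (is_RInt_unique (V := R_CompleteNormedModule)).
  replace (A / 2 * (exp (2 * K * x) - 1))
    with (minus (A / 2 * exp (2 * K * x)) (A / 2 * exp (2 * K * 0))).
  - apply (is_RInt_derive (V := R_CompleteNormedModule) (fun t => A / 2 * exp (2 * K * t))).
    + intros t _. auto_derive; [exact I|]. field.
    + intros t _. apply continuous_exp_lin.
  - unfold minus, plus, opp; simpl. rewrite Rmult_0_r, exp_0. ring.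
Qed.

Lemma exp_ge_1_lin (y : R) : 0 <= y -> y + 1 <= exp y.
Proof.
  intros [H|<-].
  - pose proof (exp_ineq1 y); lra.
  - rewrite exp_0; lra.
Qed.

(* Measuring increments against exp (2 K x) halves them at every step, so the iteration
   converges geometrically on every bounded interval without subdividing it. *)
Lemma picard_iter_step (g Phi : R -> R) (K B : R) (n : nat) :
  0 < K -> (forall x y, Rabs (g x - g y) <= K * Rabs (x - y)) ->
  (forall x, Rabs (g x) <= B) -> (forall x, continuous Phi x) ->
  forall x, 0 <= x ->
  Rabs (picard_iter g Phi (S n) x - picard_iter g Phi n x)
    <= B / (2 * K) * (/ 2) ^ n * exp (2 * K * x).
Proof.
  intros HK Hg HB HP.
  assert (Hgc := lipschitz_continuous g K Hg).
  assert (Hcomp : forall m x, continuous (fun t => g (picard_iter g Phi m t + Phi t)) x).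
  { intros m x. apply (continuous_comp (fun t => picard_iter g Phi m t + Phi t) g); [|apply Hgc].
    apply (continuous_plus (picard_iter g Phi m) Phi); auto using picard_iter_continuous. }
  assert (HB0 : 0 <= B) by (apply Rle_trans with (2 := HB 0), Rabs_pos).
  induction n as [|n IH]; intros x Hx.
  - change (picard_iter g Phi 0 x) with 0. rewrite Rminus_0_r. simpl (_ ^ 0).
    change (picard_iter g Phi 1 x) with (RInt (fun t => g (picard_iter g Phi 0 t + Phi t)) 0 x).
    apply Rle_trans with (RInt (fun _ => B) 0 x).
    + apply RInt_abs_le; auto. intros; apply continuous_const.
    + rewrite RInt_const. change (scal (x - 0) B) with ((x - 0) * B).
      replace ((x - 0) * B) with (B / (2 * K) * 1 * (2 * K * x)) by (field; lra).
      apply Rmult_le_compat_l.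
      * rewrite Rmult_1_r. apply Rdiv_le_0_compat; lra.
      * pose proof (exp_ge_1_lin (2 * K * x)) as He.
        assert (0 <= 2 * K * x) by (apply Rmult_le_pos; lra). specialize (He H). lra.
  - assert (Hs : picard_iter g Phi (S (S n)) x - picard_iter g Phi (S n) x =
             RInt (fun t => g (picard_iter g Phi (S n) t + Phi t)
                            - g (picard_iter g Phi n t + Phi t)) 0 x).
    { symmetry. apply (RInt_minus (V := R_CompleteNormedModule)
        (fun t => g (picard_iter g Phi (S n) t + Phi t))
        (fun t => g (picard_iter g Phi n t + Phi t))); apply continuous_ex_RInt, Hcomp. }
    rewrite Hs.
    apply Rle_trans with
      (RInt (fun t => K * (B / (2 * K) * (/ 2) ^ n) * exp (2 * K * t)) 0 x).
    + apply RInt_abs_le; auto.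
      * intros y. apply (continuous_minus (fun t => g (picard_iter g Phi (S n) t + Phi t))
        (fun t => g (picard_iter g Phi n t + Phi t))); apply Hcomp.
      * intros; apply continuous_exp_lin.
      * intros t Ht. apply Rle_trans with (1 := Hg _ _). rewrite Rmult_assoc.
        apply Rmult_le_compat_l; [lra|].
        replace (picard_iter g Phi (S n) t + Phi t - (picard_iter g Phi n t + Phi t))
          with (picard_iter g Phi (S n) t - picard_iter g Phi n t) by ring.
        apply IH; lra.
    + rewrite RInt_exp_lin by exact HK.
      assert (0 <= B / (2 * K) * (/ 2) ^ n).
      { apply Rmult_le_pos; [apply Rdiv_le_0_compat; lra|apply pow_le; lra]. }
      simpl (_ ^ S n). nra.
Qed.

Lemma picard_iter_cauchy (g Phi : R -> R) (K B : R) (n k : nat) :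
  0 < K -> (forall x y, Rabs (g x - g y) <= K * Rabs (x - y)) ->
  (forall x, Rabs (g x) <= B) -> (forall x, continuous Phi x) ->
  forall x, 0 <= x ->
  Rabs (picard_iter g Phi (n + k) x - picard_iter g Phi n x)
    <= B / K * exp (2 * K * x) * (/ 2) ^ n * (1 - (/ 2) ^ k).
Proof.
  intros HK Hg HB HP x Hx. induction k as [|k IH].
  - rewrite Nat.add_0_r, Rminus_diag, Rabs_R0. simpl. lra.
  - rewrite Nat.add_succ_r.
    pose proof (picard_iter_step g Phi K B (n + k) HK Hg HB HP x Hx) as Hs.
    replace (picard_iter g Phi (S (n + k)) x - picard_iter g Phi n x)
      with ((picard_iter g Phi (S (n + k)) x - picard_iter g Phi (n + k) x)
            + (picard_iter g Phi (n + k) x - picard_iter g Phi n x)) by ring.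
    apply Rle_trans with (1 := Rabs_triang _ _).
    apply Rle_trans with (1 := Rplus_le_compat _ _ _ _ Hs IH).
    rewrite pow_add. simpl (_ ^ S k). right. field. lra.
Qed.

Lemma pow_half_small (A e : R) : 0 < e -> exists n, A * (/ 2) ^ n < e.
Proof.
  intros He. destruct (pow_lt_1_zero (/ 2)) with (y := e / (Rabs A + 1)) as [N HN].
  - rewrite Rabs_pos_eq; lra.
  - apply Rdiv_lt_0_compat; [lra|]. pose proof (Rabs_pos A); lra.
  - exists N. specialize (HN N (Nat.le_refl N)).
    pose proof (Rabs_pos A). pose proof (Rle_abs A).
    assert (Hp : 0 < (/ 2) ^ N) by (apply pow_lt; lra).
    rewrite Rabs_pos_eq in HN by lra.
    apply Rle_lt_trans with ((Rabs A + 1) * (/ 2) ^ N); [nra|].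
    apply Rmult_lt_compat_l with (r := Rabs A + 1) in HN; [|lra].
    replace ((Rabs A + 1) * (e / (Rabs A + 1))) with e in HN by (field; lra). exact HN.
Qed.

Lemma le_of_pow_half (x y A : R) : (forall n, x <= y + A * (/ 2) ^ n) -> x <= y.
Proof.
  intros H. destruct (Rle_dec x y) as [|Hn]; [assumption|].
  destruct (pow_half_small A (x - y)) as [n Hn']; [lra|]. specialize (H n). lra.
Qed.

Definition picard_lim (g Phi : R -> R) (x : R) : R :=
  real (Lim_seq (fun n => picard_iter g Phi n (Rmax 0 x))).

Lemma picard_lim_bound (g Phi : R -> R) (K B : R) (n : nat) :
  0 < K -> (forall x y, Rabs (g x - g y) <= K * Rabs (x - y)) ->
  (forall x, Rabs (g x) <= B) -> (forall x, continuous Phi x) ->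
  forall x, 0 <= x ->
  Rabs (picard_lim g Phi x - picard_iter g Phi n x) <= B / K * exp (2 * K * x) * (/ 2) ^ n.
Proof.
  intros HK Hg HB HP x Hx.
  assert (HA : 0 <= B / K * exp (2 * K * x)).
  { apply Rmult_le_pos; [|left; apply exp_pos].
    apply Rdiv_le_0_compat; [|lra]. apply Rle_trans with (2 := HB 0), Rabs_pos. }
  assert (Hcau : forall n k, Rabs (picard_iter g Phi (n + k) x - picard_iter g Phi n x)
                      <= B / K * exp (2 * K * x) * (/ 2) ^ n).
  { intros m k. apply Rle_trans with (1 := picard_iter_cauchy g Phi K B m k HK Hg HB HP x Hx).
    assert (0 < (/ 2) ^ k) by (apply pow_lt; lra).
    assert (0 <= B / K * exp (2 * K * x) * (/ 2) ^ m).
    { apply Rmult_le_pos; [exact HA|apply pow_le; lra]. }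
    nra. }
  unfold picard_lim. rewrite Rmax_right by exact Hx.
  set (p := fun n => picard_iter g Phi n x) in *.
  assert (Hlim : ex_finite_lim_seq p).
  { apply ex_lim_seq_cauchy_corr. intros e.
    destruct (pow_half_small (2 * (B / K * exp (2 * K * x))) e) as [N HN]; [apply cond_pos|].
    exists N. intros i j Hi Hj.
    replace i with (N + (i - N))%nat by lia. replace j with (N + (j - N))%nat by lia.
    pose proof (Hcau N (i - N)%nat) as H1. pose proof (Hcau N (j - N)%nat) as H2.
    unfold p. apply Rabs_le_between in H1, H2. apply Rabs_def1; lra. }
  destruct Hlim as [l Hl]. rewrite (is_lim_seq_unique _ _ Hl). simpl.
  assert (Hlk : is_lim_seq (fun k => Rabs (p (k + n)%nat - p n)) (Rabs (l - p n))).
  { apply (is_lim_seq_abs _ (Finite (l - p n))).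
    apply is_lim_seq_minus'; [|apply is_lim_seq_const].
    apply (is_lim_seq_incr_n p n (Finite l)), Hl. }
  apply (is_lim_seq_le _ _ (Finite (Rabs (l - p n))) (Finite _)
    (fun k => eq_ind_r (fun j => Rabs (p j - p n) <= _) (Hcau n k) (Nat.add_comm k n)) Hlk
    (is_lim_seq_const _)).
Qed.

Lemma picard_iter_lipschitz (g Phi : R -> R) (K B : R) (n : nat) :
  (forall x y, Rabs (g x - g y) <= K * Rabs (x - y)) ->
  (forall x, Rabs (g x) <= B) -> (forall x, continuous Phi x) ->
  forall x y, Rabs (picard_iter g Phi n x - picard_iter g Phi n y) <= B * Rabs (x - y).
Proof.
  intros Hg HB HP x y.
  assert (HB0 : 0 <= B) by (apply Rle_trans with (2 := HB 0), Rabs_pos).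
  destruct n as [|n].
  { simpl. rewrite Rminus_diag, Rabs_R0. apply Rmult_le_pos; [exact HB0|apply Rabs_pos]. }
  assert (Hc : forall x, continuous (fun t => g (picard_iter g Phi n t + Phi t)) x).
  { intros u. apply (continuous_comp (fun t => picard_iter g Phi n t + Phi t) g).
    - apply (continuous_plus (picard_iter g Phi n) Phi); [|apply HP].
      apply picard_iter_continuous; auto. apply (lipschitz_continuous g K Hg).
    - apply (lipschitz_continuous g K Hg). }
  simpl. set (f := fun t => g (picard_iter g Phi n t + Phi t)) in *.
  assert (Hle : forall u v, u <= v -> Rabs (RInt f 0 v - RInt f 0 u) <= B * Rabs (v - u)).
  { intros u v Huv.
    replace (RInt f 0 v - RInt f 0 u) with (RInt f u v).
    - rewrite (Rabs_pos_eq (v - u)) by lra. rewrite Rmult_comm.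
      apply Rle_trans with (RInt (fun _ => B) u v).
      + apply RInt_abs_le; auto; [intros; apply continuous_const|]. intros; apply HB.
      + rewrite RInt_const. apply Rle_refl.
    - assert (H : RInt f 0 u + RInt f u v = RInt f 0 v)
        by exact (RInt_Chasles (V := R_CompleteNormedModule) f 0 u v
                    (continuous_ex_RInt f 0 u Hc) (continuous_ex_RInt f u v Hc)).
      lra. }
  destruct (Rle_dec y x).
  - apply Hle; lra.
  - rewrite Rabs_minus_sym, (Rabs_minus_sym x y). apply Hle; lra.
Qed.

Lemma Rmax_lipschitz (u x y : R) : Rabs (Rmax u x - Rmax u y) <= Rabs (x - y).
Proof.
  unfold Rmax; destruct (Rle_dec u x), (Rle_dec u y);
    unfold Rabs; repeat destruct (Rcase_abs _); lra.
Qed.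

Lemma picard_lim_continuous (g Phi : R -> R) (K B : R) :
  0 < K -> (forall x y, Rabs (g x - g y) <= K * Rabs (x - y)) ->
  (forall x, Rabs (g x) <= B) -> (forall x, continuous Phi x) ->
  forall x, continuous (picard_lim g Phi) x.
Proof.
  intros HK Hg HB HP.
  assert (HB0 : 0 <= B) by (apply Rle_trans with (2 := HB 0), Rabs_pos).
  assert (Hm : forall x, picard_lim g Phi x = picard_lim g Phi (Rmax 0 x)).
  { intros x. unfold picard_lim. rewrite (Rmax_right 0 (Rmax 0 x)) by apply Rmax_l. reflexivity. }
  apply (lipschitz_continuous _ B). intros x y. rewrite (Hm x), (Hm y).
  apply Rle_trans with (B * Rabs (Rmax 0 x - Rmax 0 y)).
  2: apply Rmult_le_compat_l; [exact HB0|apply Rmax_lipschitz].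
  assert (Hx := Rmax_l 0 x). assert (Hy := Rmax_l 0 y).
  set (u := Rmax 0 x) in *. set (v := Rmax 0 y) in *.
  apply le_of_pow_half with (B / K * exp (2 * K * u) + B / K * exp (2 * K * v)). intros n.
  pose proof (picard_lim_bound g Phi K B n HK Hg HB HP u Hx) as H1.
  pose proof (picard_lim_bound g Phi K B n HK Hg HB HP v Hy) as H2.
  pose proof (picard_iter_lipschitz g Phi K B n Hg HB HP u v) as H3.
  rewrite Rmult_plus_distr_r.
  apply Rabs_le_between in H1, H2, H3. apply Rabs_le. lra.
Qed.

Lemma picard_lim_solves (g Phi : R -> R) (K B : R) :
  0 < K -> (forall x y, Rabs (g x - g y) <= K * Rabs (x - y)) ->
  (forall x, Rabs (g x) <= B) -> (forall x, continuous Phi x) ->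
  forall x, 0 <= x ->
  picard_lim g Phi x = RInt (fun t => g (picard_lim g Phi t + Phi t)) 0 x.
Proof.
  intros HK Hg HB HP x Hx.
  assert (Hgc := lipschitz_continuous g K Hg).
  assert (Hcl : forall x, continuous (fun t => g (picard_lim g Phi t + Phi t)) x).
  { intros y. apply (continuous_comp (fun t => picard_lim g Phi t + Phi t) g); [|apply Hgc].
    apply (continuous_plus (picard_lim g Phi) Phi); [|apply HP].
    apply (picard_lim_continuous g Phi K B); auto. }
  assert (Hcn : forall n x, continuous (fun t => g (picard_iter g Phi n t + Phi t)) x).
  { intros n y. apply (continuous_comp (fun t => picard_iter g Phi n t + Phi t) g); [|apply Hgc].
    apply (continuous_plus (picard_iter g Phi n) Phi); auto using picard_iter_continuous. }
  assert (HB0 : 0 <= B) by (apply Rle_trans with (2 := HB 0), Rabs_pos).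
  assert (HBK : 0 <= B / K) by (apply Rdiv_le_0_compat; lra).
  set (f := fun t => g (picard_lim g Phi t + Phi t)) in *.
  assert (H : forall n, Rabs (picard_lim g Phi x - RInt f 0 x)
                <= 0 + (2 * (B / K) * exp (2 * K * x)) * (/ 2) ^ n).
  { intros n.
    pose proof (picard_lim_bound g Phi K B (S n) HK Hg HB HP x Hx) as H1.
    assert (H2 : Rabs (picard_iter g Phi (S n) x - RInt f 0 x)
                 <= B / K * exp (2 * K * x) * (/ 2) ^ n).
    { assert (Hs : picard_iter g Phi (S n) x - RInt f 0 x =
               RInt (fun t => g (picard_iter g Phi n t + Phi t) - f t) 0 x).
      { symmetry. apply (RInt_minus (V := R_CompleteNormedModule)
          (fun t => g (picard_iter g Phi n t + Phi t)) f); apply continuous_ex_RInt; auto. }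
      rewrite Hs.
      apply Rle_trans with (RInt (fun t => K * (B / K * (/ 2) ^ n) * exp (2 * K * t)) 0 x).
      - apply RInt_abs_le; auto.
        + intros y. apply (continuous_minus (fun t => g (picard_iter g Phi n t + Phi t)) f); auto.
        + intros; apply continuous_exp_lin.
        + intros t Ht. apply Rle_trans with (1 := Hg _ _). rewrite Rmult_assoc.
          apply Rmult_le_compat_l; [lra|].
          replace (picard_iter g Phi n t + Phi t - (picard_lim g Phi t + Phi t))
            with (- (picard_lim g Phi t - picard_iter g Phi n t)) by ring.
          rewrite Rabs_Ropp.
          apply Rle_trans with (1 := picard_lim_bound g Phi K B n HK Hg HB HP t ltac:(lra)).
          right; ring.
      - rewrite RInt_exp_lin by exact HK.
        assert (0 <= B / K * (/ 2) ^ n) by (apply Rmult_le_pos; [lra|apply pow_le; lra]).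
        pose proof (exp_pos (2 * K * x)). nra. }
    assert (H3 : 0 <= B / K * exp (2 * K * x) * (/ 2) ^ n).
    { apply Rmult_le_pos; [|apply pow_le; lra]. apply Rmult_le_pos; [lra|left; apply exp_pos]. }
    simpl (_ ^ S n) in H1. apply Rabs_le_between in H1, H2. apply Rabs_le. lra. }
  apply le_of_pow_half in H. pose proof (Rabs_pos (picard_lim g Phi x - RInt f 0 x)).
  assert (H0' : Rabs (picard_lim g Phi x - RInt f 0 x) = 0) by lra.
  apply Rabs_eq_0 in H0'. lra.
Qed.

Lemma picard_iter_dep (g Phi Psi : R -> R) (K X delta : R) (n : nat) :
  0 < K -> (forall x y, Rabs (g x - g y) <= K * Rabs (x - y)) ->
  (forall x, continuous Phi x) -> (forall x, continuous Psi x) ->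
  0 <= delta -> (forall t, 0 <= t <= X -> Rabs (Phi t - Psi t) <= delta) ->
  forall x, 0 <= x <= X ->
  Rabs (picard_iter g Phi n x - picard_iter g Psi n x) <= delta * exp (2 * K * x).
Proof.
  intros HK Hg HP HQ Hd Hdist.
  assert (Hgc := lipschitz_continuous g K Hg).
  assert (Hcn : forall Q n x, (forall x, continuous Q x) ->
            continuous (fun t => g (picard_iter g Q n t + Q t)) x).
  { intros Q m y HQc. apply (continuous_comp (fun t => picard_iter g Q m t + Q t) g); [|apply Hgc].
    apply (continuous_plus (picard_iter g Q m) Q); auto using picard_iter_continuous. }
  induction n as [|n IH]; intros x Hx.
  - simpl. rewrite Rminus_diag, Rabs_R0. apply Rmult_le_pos; [lra|left; apply exp_pos].
  - assert (Hs : picard_iter g Phi (S n) x - picard_iter g Psi (S n) x =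
             RInt (fun t => g (picard_iter g Phi n t + Phi t)
                            - g (picard_iter g Psi n t + Psi t)) 0 x).
    { symmetry. apply (RInt_minus (V := R_CompleteNormedModule)
        (fun t => g (picard_iter g Phi n t + Phi t))
        (fun t => g (picard_iter g Psi n t + Psi t))); apply continuous_ex_RInt; auto. }
    rewrite Hs.
    apply Rle_trans with (RInt (fun t => K * (2 * delta) * exp (2 * K * t)) 0 x).
    + apply RInt_abs_le; [lra| | |].
      * intros y. apply (continuous_minus (fun t => g (picard_iter g Phi n t + Phi t))
        (fun t => g (picard_iter g Psi n t + Psi t))); auto.
      * intros; apply continuous_exp_lin.
      * intros t Ht. apply Rle_trans with (1 := Hg _ _). rewrite Rmult_assoc.
        apply Rmult_le_compat_l; [lra|].
        pose proof (IH t ltac:(lra)) as H1. pose proof (Hdist t ltac:(lra)) as H2.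
        assert (1 <= exp (2 * K * t)).
        { pose proof (exp_ge_1_lin (2 * K * t) ltac:(apply Rmult_le_pos; lra)).
          assert (0 <= 2 * K * t) by (apply Rmult_le_pos; lra). lra. }
        assert (delta <= delta * exp (2 * K * t)) by nra.
        apply Rabs_le_between in H1, H2. apply Rabs_le. lra.
    + rewrite RInt_exp_lin by exact HK. lra.
Qed.

Lemma picard_lim_dep (g Phi Psi : R -> R) (K B X delta : R) :
  0 < K -> (forall x y, Rabs (g x - g y) <= K * Rabs (x - y)) ->
  (forall x, Rabs (g x) <= B) ->
  (forall x, continuous Phi x) -> (forall x, continuous Psi x) ->
  0 <= delta -> (forall t, 0 <= t <= X -> Rabs (Phi t - Psi t) <= delta) ->
  forall x, 0 <= x <= X ->
  Rabs (picard_lim g Phi x - picard_lim g Psi x) <= delta * exp (2 * K * x).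
Proof.
  intros HK Hg HB HP HQ Hd Hdist x Hx.
  apply le_of_pow_half with (2 * (B / K * exp (2 * K * x))). intros n.
  pose proof (picard_lim_bound g Phi K B n HK Hg HB HP x ltac:(lra)) as H1.
  pose proof (picard_lim_bound g Psi K B n HK Hg HB HQ x ltac:(lra)) as H2.
  pose proof (picard_iter_dep g Phi Psi K X delta n HK Hg HP HQ Hd Hdist x Hx) as H3.
  apply Rabs_le_between in H1, H2, H3. apply Rabs_le. lra.
Qed.

(** * Existence of the principal eigenvalue *)

Lemma continuous_eps (f : R -> R) (x e : R) :
  continuous f x -> 0 < e ->
  exists de, 0 < de /\ forall t, Rabs (t - x) < de -> Rabs (f t - f x) < e.
Proof.
  intros Hf He.
  destruct (proj1 (filterlim_locally f (f x)) Hf (mkposreal e He)) as [de Hde].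
  exists de. split; [apply cond_pos|]. intros t Ht. exact (Hde t Ht).
Qed.

Lemma last_time (f : R -> R) (x y beta : R) :
  (forall t, continuous f t) -> x <= y -> beta <= f x -> f y < beta ->
  exists u, x <= u < y /\ f u = beta /\ forall t, u < t <= y -> f t < beta.
Proof.
  intros Hf Hxy Hx Hy.
  destruct (completeness (fun t => x <= t <= y /\ beta <= f t)) as [u [Hub Hlub]].
  - exists y. intros t Ht. apply Ht.
  - exists x. split; [lra|exact Hx].
  - assert (Hxu : x <= u) by (apply Hub; split; [lra|exact Hx]).
    assert (Huy : u <= y) by (apply Hlub; intros t Ht; apply Ht).
    assert (Hafter : forall t, u < t <= y -> f t < beta).
    { intros t Ht. destruct (Rlt_dec (f t) beta) as [|Hn]; [assumption|].
      assert (t <= u) by (apply Hub; split; lra). lra. }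
    assert (Hge : beta <= f u).
    { destruct (Rle_dec beta (f u)) as [|Hn]; [assumption|].
      destruct (continuous_eps f u (beta - f u) (Hf u) ltac:(lra)) as [de [Hde Hc]].
      assert (u <= u - de).
      { apply Hlub. intros t [Ht1 Ht2]. assert (t <= u) by (apply Hub; split; lra).
        destruct (Rle_dec t (u - de)) as [|Hn']; [assumption|].
        specialize (Hc t ltac:(apply Rabs_def1; lra)). apply Rabs_def2 in Hc. lra. }
      lra. }
    assert (Hlt : u < y) by (destruct Huy as [|<-]; lra).
    exists u. split; [lra|]. split; [|exact Hafter].
    destruct (Rle_dec (f u) beta) as [|Hn]; [lra|].
    destruct (continuous_eps f u (f u - beta) (Hf u) ltac:(lra)) as [de [Hde Hc]].
    set (t := u + Rmin (de / 2) (y - u)).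
    assert (Ht : 0 < Rmin (de / 2) (y - u)) by (apply Rmin_glb_lt; lra).
    pose proof (Rmin_l (de / 2) (y - u)). pose proof (Rmin_r (de / 2) (y - u)).
    specialize (Hc t ltac:(unfold t; apply Rabs_def1; lra)). apply Rabs_def2 in Hc.
    specialize (Hafter t ltac:(unfold t; lra)). lra.
Qed.

Lemma crossing_down (f : R -> R) (x y alpha beta : R) :
  (forall t, continuous f t) -> x <= y -> alpha < beta -> beta <= f x -> f y <= alpha ->
  exists u v, x <= u /\ u <= v /\ v <= y /\ f u = beta /\ f v = alpha /\
    forall t, u <= t <= v -> alpha <= f t <= beta.
Proof.
  intros Hf Hxy Hab Hx Hy.
  destruct (last_time f x y beta Hf Hxy Hx ltac:(lra)) as [u [Hu [Hfu Hafter]]].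
  destruct (last_time (fun t => - f (- t)) (- y) (- u) (- alpha)) as [v [Hv [Hfv Hbefore]]].
  - intros t. apply (continuous_opp (fun t => f (- t))).
    apply (continuous_comp (fun t => - t) f); [|apply Hf].
    apply (ex_derive_continuous (fun t : R => - t)). auto_derive. exact I.
  - lra.
  - rewrite Ropp_involutive; lra.
  - rewrite Ropp_involutive; lra.
  - exists u, (- v). repeat split; try lra.
    + destruct (Req_dec t (- v)) as [->|Hn]; [lra|].
      specialize (Hbefore (- t) ltac:(lra)). rewrite Ropp_involutive in Hbefore. lra.
    + destruct (Req_dec t u) as [->|Hn]; [lra|].
      specialize (Hafter t ltac:(lra)). lra.
Qed.

Lemma crossing_up (f : R -> R) (x y alpha beta : R) :
  (forall t, continuous f t) -> x <= y -> alpha < beta -> f x <= alpha -> beta <= f y ->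
  exists u v, x <= u /\ u <= v /\ v <= y /\ f u = alpha /\ f v = beta /\
    forall t, u <= t <= v -> alpha <= f t <= beta.
Proof.
  intros Hf Hxy Hab Hx Hy.
  destruct (crossing_down (fun t => - f t) x y (- beta) (- alpha))
    as [u [v [H1 [H2 [H3 [H4 [H5 H6]]]]]]]; try lra.
  - intros t. apply (continuous_opp f), Hf.
  - exists u, v. repeat split; try lra; specialize (H6 t ltac:(lra)); lra.
Qed.

Lemma RInt_bounds (f : R -> R) (u v lo hi : R) :
  u <= v -> (forall x, continuous f x) -> (forall x, u <= x <= v -> lo <= f x <= hi) ->
  lo * (v - u) <= RInt f u v <= hi * (v - u).
Proof.
  intros Huv Hf Hb.
  assert (Hcst : forall k, RInt (fun _ => k) u v = k * (v - u)).
  { intros k. rewrite RInt_const. apply Rmult_comm. }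
  rewrite <- !Hcst. split; apply RInt_le; auto;
    try (apply continuous_ex_RInt; auto; intros; apply continuous_const);
    intros x Hx; apply Hb; lra.
Qed.

Lemma RInt_split (f : R -> R) (t u v : R) :
  (forall x, continuous f x) -> RInt f t v - RInt f t u = RInt f u v.
Proof.
  intros Hc.
  assert (H : RInt f t u + RInt f u v = RInt f t v)
    by exact (RInt_Chasles (V := R_CompleteNormedModule) f t u v
                (continuous_ex_RInt f t u Hc) (continuous_ex_RInt f u v Hc)).
  lra.
Qed.

(* [y] stands for the logarithmic derivative [phi' / phi] of an eigenfunction and [b] for
   [a / d]: the eigenvalue problem with potential [r - chi c] becomes a Riccati equation. *)
Definition riccati_eig (b d r x1 L lam : R) (c : R -> R) : Prop :=
  exists y : R -> R,
    (forall x, continuous y x) /\ y 0 = b /\ y L = 0 /\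
    (forall x, 0 < x < x1 -> is_derive y x (- y x ^ 2 + b * y x + (lam - r) / d)) /\
    (forall x, x1 < x < L -> is_derive y x (- y x ^ 2 + b * y x + (lam - r + c x) / d)).

Definition clamp (u v x : R) : R := Rmax u (Rmin v x).

Lemma clamp_bounds (u v x : R) : u <= v -> u <= clamp u v x <= v.
Proof.
  intros H. unfold clamp. split; [apply Rmax_l|]. apply Rmax_lub; [exact H|apply Rmin_l].
Qed.

Lemma clamp_id (u v x : R) : u <= x <= v -> clamp u v x = x.
Proof. intros H. unfold clamp. rewrite Rmin_right, Rmax_right; lra. Qed.

Lemma clamp_lipschitz (u v x y : R) : Rabs (clamp u v x - clamp u v y) <= Rabs (x - y).
Proof.
  unfold clamp. apply Rle_trans with (1 := Rmax_lipschitz _ _ _).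
  unfold Rmin; destruct (Rle_dec v x), (Rle_dec v y);
    unfold Rabs; repeat destruct (Rcase_abs _); lra.
Qed.

Definition truncated_quad (b P y : R) : R := clamp (- P) P y * (b - clamp (- P) P y).

Lemma truncated_quad_lipschitz (b P x y : R) :
  0 <= b -> 0 <= P ->
  Rabs (truncated_quad b P x - truncated_quad b P y) <= (b + 2 * P) * Rabs (x - y).
Proof.
  intros Hb HP. unfold truncated_quad.
  pose proof (clamp_bounds (- P) P x ltac:(lra)). pose proof (clamp_bounds (- P) P y ltac:(lra)).
  pose proof (clamp_lipschitz (- P) P x y) as HL.
  set (u := clamp (- P) P x) in *. set (v := clamp (- P) P y) in *.
  replace (u * (b - u) - v * (b - v)) with ((b - u - v) * (u - v)) by ring.
  rewrite Rabs_mult. apply Rmult_le_compat; try apply Rabs_pos; [|exact HL].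
  apply Rabs_le. lra.
Qed.

Lemma truncated_quad_bounded (b P y : R) :
  0 <= b -> 0 <= P -> Rabs (truncated_quad b P y) <= P * (b + P).
Proof.
  intros Hb HP. unfold truncated_quad. pose proof (clamp_bounds (- P) P y ltac:(lra)).
  rewrite Rabs_mult. apply Rmult_le_compat; try apply Rabs_pos; apply Rabs_le; lra.
Qed.

Lemma truncated_quad_le (b P y : R) : truncated_quad b P y <= b ^ 2 / 4.
Proof. unfold truncated_quad. pose proof (pow2_ge_0 (clamp (- P) P y - b / 2)). nra. Qed.

(* The Riccati equation integrated, apart from its quadratic part. *)
Definition riccati_forcing (b d r x1 : R) (c : R -> R) (lam x : R) : R :=
  b + (lam - r) / d * x + / d * RInt c x1 (Rmax x1 x).

Lemma continuous_Rmax (u x : R) : continuous (Rmax u) x.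
Proof.
  apply (lipschitz_continuous _ 1). intros y z. rewrite Rmult_1_l. apply Rmax_lipschitz.
Qed.

Lemma continuous_lin (k x : R) : continuous (fun t => k * t) x.
Proof. apply (ex_derive_continuous (fun t => k * t)). auto_derive. exact I. Qed.

Lemma riccati_forcing_continuous (b d r x1 : R) (c : R -> R) (lam : R) :
  (forall x, continuous c x) -> forall x, continuous (riccati_forcing b d r x1 c lam) x.
Proof.
  intros Hc x. unfold riccati_forcing.
  apply (continuous_plus (fun x => b + (lam - r) / d * x) (fun x => / d * RInt c x1 (Rmax x1 x))).
  - apply (continuous_plus (fun _ => b) (fun x => (lam - r) / d * x)).
    + apply continuous_const.
    + apply continuous_lin.
  - apply (continuous_comp (fun x => RInt c x1 (Rmax x1 x)) (fun t => / d * t)).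
    + apply (continuous_comp (Rmax x1) (fun y => RInt c x1 y)).
      * apply continuous_Rmax.
      * apply continuous_primitive, Hc.
    + apply continuous_lin.
Qed.

Lemma riccati_forcing_increment (b d r x1 L C : R) (c : R -> R) (lam u v : R) :
  0 < d -> x1 <= L -> (forall x, continuous c x) -> (forall x, x1 <= x <= L -> 0 <= c x <= C) ->
  u <= v -> v <= L ->
  (lam - r) / d * (v - u)
    <= riccati_forcing b d r x1 c lam v - riccati_forcing b d r x1 c lam u
    <= (lam - r + C) / d * (v - u).
Proof.
  intros Hd HxL Hc Hb Huv HvL. unfold riccati_forcing.
  assert (HC : 0 <= C) by (specialize (Hb L ltac:(lra)); lra).
  assert (Hm : 0 <= Rmax x1 v - Rmax x1 u <= v - u).
  { unfold Rmax; destruct (Rle_dec x1 v), (Rle_dec x1 u); lra. }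
  assert (Hr : Rmax x1 v <= L) by (apply Rmax_lub; lra).
  pose proof (Rmax_l x1 u) as Hl.
  pose proof (RInt_split c x1 (Rmax x1 u) (Rmax x1 v) Hc) as Hs.
  pose proof (RInt_bounds c (Rmax x1 u) (Rmax x1 v) 0 C ltac:(lra) Hc) as Hi.
  specialize (Hi ltac:(intros; apply Hb; lra)).
  set (I := RInt c (Rmax x1 u) (Rmax x1 v)) in *.
  assert (HI : 0 <= I <= C * (v - u)) by nra.
  assert (Hid : 0 < / d) by (apply Rinv_0_lt_compat, Hd).
  replace (b + (lam - r) / d * v + / d * RInt c x1 (Rmax x1 v) -
           (b + (lam - r) / d * u + / d * RInt c x1 (Rmax x1 u)))
    with ((lam - r) / d * (v - u) + / d * I) by (rewrite <- Hs; ring).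
  unfold Rdiv. split; nra.
Qed.

(* Truncating the quadratic term makes the equation globally solvable; the value at [L] is
   continuous in [lam] and changes sign, and at the zero the bounds below show that the
   truncation was never active. *)
Theorem riccati_eig_exists (b d r x1 L C : R) (c : R -> R) :
  0 < b -> 0 < d -> 0 <= x1 < L -> (forall x, continuous c x) ->
  (forall x, x1 <= x <= L -> 0 <= c x <= C) ->
  exists lam, riccati_eig b d r x1 L lam c.
Proof.
  intros Hb Hd Hx1 Hc HcC.
  assert (HC : 0 <= C) by (specialize (HcC L ltac:(lra)); lra).
  assert (HCd : 0 <= C / d) by (apply Rdiv_le_0_compat; lra).
  assert (HLb : 0 <= L * (b ^ 2 / 4 + C / d)) by (apply Rmult_le_pos; nra).
  set (P := 2 + b + C / d + L * (b ^ 2 / 4 + C / d)).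
  set (K := b + 2 * P). set (B := P * (b + P)).
  assert (HP : 2 + C / d <= P /\ b + L * (b ^ 2 / 4 + C / d) <= P /\ b <= P) by (unfold P; lra).
  assert (HK : 0 < K) by (unfold K; lra).
  set (g := truncated_quad b P).
  assert (Hg : forall x y, Rabs (g x - g y) <= K * Rabs (x - y)).
  { intros; apply truncated_quad_lipschitz; lra. }
  assert (HB : forall x, Rabs (g x) <= B) by (intros; apply truncated_quad_bounded; lra).
  assert (Hgc := lipschitz_continuous g K Hg).
  set (T := riccati_forcing b d r x1 c).
  assert (HT : forall lam x, continuous (T lam) x).
  { intros lam. apply riccati_forcing_continuous, Hc. }
  set (y := fun lam x => picard_lim g (T lam) x + T lam x).
  assert (Hy : forall lam x, continuous (y lam) x).
  { intros lam x. apply (continuous_plus (picard_lim g (T lam)) (T lam)); [|apply HT].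
    apply (picard_lim_continuous g (T lam) K B); auto. }
  assert (Hgy : forall lam x, continuous (fun t => g (y lam t)) x).
  { intros lam x. apply (continuous_comp (y lam) g); auto. }
  assert (Hsol : forall lam x, 0 <= x -> y lam x = RInt (fun t => g (y lam t)) 0 x + T lam x).
  { intros lam x Hx. unfold y at 1. f_equal.
    apply (picard_lim_solves g (T lam) K B); auto. }
  assert (Hy0 : forall lam, y lam 0 = b).
  { intros lam. rewrite Hsol by lra. rewrite RInt_point. unfold T, riccati_forcing.
    rewrite Rmax_left by lra. rewrite RInt_point. change zero with 0. ring. }
  assert (Hinc : forall lam u v lo hi, 0 <= u -> u <= v -> v <= L ->
            (forall t, u <= t <= v -> lo <= g (y lam t) <= hi) ->
            (lo + (lam - r) / d) * (v - u) <= y lam v - y lam u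
              <= (hi + (lam - r + C) / d) * (v - u)).
  { intros lam u v lo hi Hu Huv HvL Hbd.
    rewrite (Hsol lam u), (Hsol lam v) by lra.
    pose proof (RInt_split (fun t => g (y lam t)) 0 u v (Hgy lam)) as H1.
    pose proof (RInt_bounds (fun t => g (y lam t)) u v lo hi Huv (Hgy lam) Hbd) as H2.
    pose proof (riccati_forcing_increment b d r x1 L C c lam u v Hd ltac:(lra) Hc HcC Huv HvL)
      as H3.
    fold T in H3. rewrite !Rmult_plus_distr_r. lra. }
  assert (Hlow' : forall z, - B <= g z).
  { intros z. specialize (HB z). apply Rabs_le_between in HB. lra. }
  assert (Hhi : 0 <= y r L).
  { destruct (Rle_dec 0 (y r L)) as [|Hn]; [assumption|exfalso].
    destruct (crossing_down (y r) 0 L 0 b (Hy r) ltac:(lra) Hb) as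
      [u [v [H1 [H2 [H3 [H4 [H5 H6]]]]]]]; [rewrite Hy0; lra|lra|].
    pose proof (Hinc r u v 0 (b ^ 2 / 4) H1 H2 H3) as H7.
    assert (H8 : (0 + (r - r) / d) * (v - u) <= y r v - y r u).
    { apply H7. intros t Ht. split; [|apply truncated_quad_le].
      specialize (H6 t Ht). unfold g, truncated_quad. rewrite clamp_id by lra.
      apply Rmult_le_pos; lra. }
    replace ((0 + (r - r) / d) * (v - u)) with 0 in H8 by (field; lra). lra. }
  set (lo := r - C - d * (b ^ 2 / 4 + b / L)).
  assert (HbL : 0 < b / L) by (apply Rdiv_lt_0_compat; lra).
  assert (Hlor : lo < r) by (unfold lo; nra).
  assert (Hlo : y lo L <= 0).
  { pose proof (Hinc lo 0 L (- B) (b ^ 2 / 4) ltac:(lra) ltac:(lra) ltac:(lra)) as H1.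
    destruct H1 as [_ H1].
    { intros t _. split; [apply Hlow'|apply truncated_quad_le]. }
    rewrite Hy0 in H1.
    replace ((b ^ 2 / 4 + (lo - r + C) / d) * (L - 0)) with (- b) in H1
      by (unfold lo; field; lra). lra. }
  assert (Hcont : forall lam, continuous (fun lam => y lam L) lam).
  { apply (lipschitz_continuous _ (L / d * exp (2 * K * L) + L / d)). intros lam mu.
    assert (Hdiff : forall t, T lam t - T mu t = t / d * (lam - mu)).
    { intros t. unfold T, riccati_forcing. field. lra. }
    assert (HTd : forall t, 0 <= t <= L -> Rabs (T lam t - T mu t) <= L / d * Rabs (lam - mu)).
    { intros t Ht. rewrite Hdiff, Rabs_mult. apply Rmult_le_compat_r; [apply Rabs_pos|].
      rewrite Rabs_pos_eq; [|apply Rdiv_le_0_compat; lra].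
      apply Rmult_le_compat_r; [|lra]. left; apply Rinv_0_lt_compat, Hd. }
    pose proof (picard_lim_dep g (T lam) (T mu) K B L (L / d * Rabs (lam - mu)) HK Hg HB
      (HT lam) (HT mu)) as Hdep.
    assert (HLd : 0 <= L / d * Rabs (lam - mu)).
    { apply Rmult_le_pos; [apply Rdiv_le_0_compat; lra|apply Rabs_pos]. }
    specialize (Hdep HLd HTd L ltac:(lra)). specialize (HTd L ltac:(lra)).
    unfold y. apply Rabs_le_between in Hdep, HTd. apply Rabs_le. lra. }
  destruct (IVT_gen (fun lam => y lam L) lo r 0) as [lam [Hlam HyL]].
  { intros lam. apply continuity_pt_filterlim, Hcont. }
  { rewrite Rmin_left, Rmax_right; lra. }
  rewrite Rmin_left, Rmax_right in Hlam by lra.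
  assert (Hneg : (lam - r) / d <= 0).
  { unfold Rdiv. pose proof (Rinv_0_lt_compat d Hd). nra. }
  assert (Hquot : (lam - r + C) / d = (lam - r) / d + C / d) by (field; lra).
  assert (Hrange : forall x, 0 <= x <= L -> - P <= y lam x <= P).
  { intros x Hx. split.
    - destruct (Rle_dec (- P) (y lam x)) as [|Hn]; [assumption|exfalso].
      destruct (crossing_up (y lam) x L (- P) (- P + 1) (Hy lam) ltac:(lra) ltac:(lra)) as
        [u [v [H1 [H2 [H3 [H4 [H5 H6]]]]]]]; [lra|lra|].
      destruct (Hinc lam u v (- B) (- (C / d)) ltac:(lra) H2 H3) as [_ H7].
      { intros t Ht. split; [apply Hlow'|]. specialize (H6 t Ht).
        unfold g, truncated_quad. rewrite clamp_id by lra. nra. }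
      rewrite Hquot in H7. nra.
    - destruct (Hinc lam 0 x (- B) (b ^ 2 / 4) ltac:(lra) ltac:(lra) ltac:(lra)) as [_ H1].
      { intros t _. split; [apply Hlow'|apply truncated_quad_le]. }
      rewrite Hy0, Hquot in H1. nra. }
  assert (Hgid : forall x, 0 <= x <= L -> g (y lam x) = - y lam x ^ 2 + b * y lam x).
  { intros x Hx. unfold g, truncated_quad. rewrite clamp_id by auto. ring. }
  assert (Hder : forall x l, 0 < x < L -> is_derive (T lam) x l ->
            is_derive (y lam) x (- y lam x ^ 2 + b * y lam x + l)).
  { intros x l Hx Hl. rewrite <- Hgid by lra.
    apply (is_derive_ext_loc (fun x => RInt (fun t => g (y lam t)) 0 x + T lam x)).
    - exists (mkposreal x (proj1 Hx)). intros t Ht. symmetry. apply Hsol.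
      apply Rabs_def2 in Ht. simpl in Ht. unfold minus, plus, opp in Ht; simpl in Ht. lra.
    - apply (is_derive_plus (fun x => RInt (fun t => g (y lam t)) 0 x) (T lam)); [|exact Hl].
      apply (is_derive_primitive (fun t => g (y lam t))), Hgy. }
  exists lam, (y lam). split; [apply Hy|]. split; [apply Hy0|]. split; [exact HyL|]. split.
  - intros x Hx. apply Hder; [lra|].
    apply (is_derive_ext_loc (fun x => b + (lam - r) / d * x)).
    + assert (Hp : 0 < x1 - x) by lra. exists (mkposreal _ Hp). intros t Ht.
      apply Rabs_def2 in Ht. unfold minus, plus, opp in Ht; simpl in Ht.
      unfold T, riccati_forcing. rewrite Rmax_left by lra. rewrite RInt_point.
      apply Rminus_diag_uniq. change zero with 0. ring.
    + auto_derive; [exact I|]. field; lra.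
  - intros x Hx. apply Hder; [lra|].
    apply (is_derive_ext_loc (fun x => b + (lam - r) / d * x + / d * RInt c x1 x)).
    + assert (Hp : 0 < x - x1) by lra. exists (mkposreal _ Hp). intros t Ht.
      apply Rabs_def2 in Ht. unfold minus, plus, opp in Ht; simpl in Ht.
      unfold T, riccati_forcing. rewrite Rmax_right by lra. reflexivity.
    + replace ((lam - r + c x) / d) with ((lam - r) / d + / d * c x) by (field; lra).
      apply (is_derive_plus (fun x => b + (lam - r) / d * x) (fun x => / d * RInt c x1 x)).
      * auto_derive; [exact I|]. field; lra.
      * apply (is_derive_scal (fun x => RInt c x1 x)), is_derive_primitive, Hc.
Qed.

(** * Comparison of eigenvalues *)

Lemma is_derive_mult_exp (f J : R -> R) (x f' J' : R) :
  is_derive f x f' -> is_derive J x J' ->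
  is_derive (fun x => f x * exp (J x)) x ((f' + f x * J') * exp (J x)).
Proof.
  intros Hf HJ. auto_derive.
  - split; [exists f'; exact Hf|]. split; [exists J'; exact HJ|exact I].
  - change (Derive (fun x => f x) x) with (Derive f x).
    change (Derive (fun x => J x) x) with (Derive J x).
    rewrite (is_derive_unique _ _ _ Hf), (is_derive_unique _ _ _ HJ). ring.
Qed.

(* The difference of two solutions satisfies a linear equation; multiplying by an
   integrating factor makes it monotone. *)
Lemma riccati_compare (b x1 L rho1 rho2 : R) (sig1 sig2 y1 y2 : R -> R) :
  0 <= x1 < L -> (forall x, continuous y1 x) -> (forall x, continuous y2 x) ->
  y2 0 <= y1 0 ->
  (forall x, 0 < x < x1 -> is_derive y1 x (- y1 x ^ 2 + b * y1 x + rho1)) ->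
  (forall x, 0 < x < x1 -> is_derive y2 x (- y2 x ^ 2 + b * y2 x + rho2)) ->
  (forall x, x1 < x < L -> is_derive y1 x (- y1 x ^ 2 + b * y1 x + sig1 x)) ->
  (forall x, x1 < x < L -> is_derive y2 x (- y2 x ^ 2 + b * y2 x + sig2 x)) ->
  rho2 <= rho1 -> (forall x, x1 < x < L -> sig2 x < sig1 x) -> y2 L < y1 L.
Proof.
  intros Hx1 Hc1 Hc2 H0 Hr1 Hr2 Hs1 Hs2 Hrho Hsig.
  set (kap := fun x => y1 x + y2 x - b).
  assert (Hkap : forall x, continuous kap x).
  { intros x. apply (continuous_minus (fun x => y1 x + y2 x) (fun _ => b)).
    - apply (continuous_plus y1 y2); auto.
    - apply continuous_const. }
  set (H := fun x => (y1 x - y2 x) * exp (RInt kap 0 x)).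
  assert (HJ : forall x, is_derive (fun x => RInt kap 0 x) x (kap x)).
  { intros x. apply is_derive_primitive, Hkap. }
  assert (HH : forall x, continuous H x).
  { intros x. apply (continuous_mult (fun x => y1 x - y2 x) (fun x => exp (RInt kap 0 x))).
    - apply (continuous_minus y1 y2); auto.
    - apply (continuous_comp (fun x => RInt kap 0 x) exp).
      + apply continuous_primitive, Hkap.
      + apply continuous_exp. }
  assert (HD : forall x s1 s2, is_derive y1 x (- y1 x ^ 2 + b * y1 x + s1) ->
            is_derive y2 x (- y2 x ^ 2 + b * y2 x + s2) ->
            is_derive H x ((s1 - s2) * exp (RInt kap 0 x))).
  { intros x s1 s2 D1 D2.
    replace (s1 - s2) with
      ((- y1 x ^ 2 + b * y1 x + s1 - (- y2 x ^ 2 + b * y2 x + s2)) + (y1 x - y2 x) * kap x)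
      by (unfold kap; ring).
    apply (is_derive_mult_exp (fun x => y1 x - y2 x) (fun x => RInt kap 0 x)); [|apply HJ].
    apply (is_derive_minus y1 y2); assumption. }
  assert (HH0 : 0 <= H 0).
  { apply Rmult_le_pos; [lra|left; apply exp_pos]. }
  assert (HH1 : H 0 <= H x1).
  { apply (derive_nonneg_le H (fun x => (rho1 - rho2) * exp (RInt kap 0 x))); auto; [lra|].
    intros x _. apply Rmult_le_pos; [lra|left; apply exp_pos]. }
  assert (HHL : H x1 < H L).
  { apply (derive_pos_lt H (fun x => (sig1 x - sig2 x) * exp (RInt kap 0 x))); auto; [lra|].
    intros x Hx. apply Rmult_lt_0_compat; [|apply exp_pos]. specialize (Hsig x Hx). lra. }
  assert (Hpos : 0 < (y1 L - y2 L) * exp (RInt kap 0 L)) by (unfold H in *; lra).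
  pose proof (exp_pos (RInt kap 0 L)). nra.
Qed.

Lemma riccati_eig_compare (b d r x1 L lam1 lam2 : R) (c1 c2 : R -> R) :
  0 < d -> 0 <= x1 < L -> riccati_eig b d r x1 L lam1 c1 -> riccati_eig b d r x1 L lam2 c2 ->
  (forall x, x1 < x < L -> lam2 + c2 x < lam1 + c1 x) -> lam1 < lam2.
Proof.
  intros Hd Hx1 [y1 [C1 [Z1 [E1 [P1 Q1]]]]] [y2 [C2 [Z2 [E2 [P2 Q2]]]]] Hlt.
  destruct (Rlt_dec lam1 lam2) as [|Hn]; [assumption|exfalso].
  assert (Hid : 0 < / d) by (apply Rinv_0_lt_compat, Hd).
  assert (H : y2 L < y1 L).
  { apply (riccati_compare b x1 L ((lam1 - r) / d) ((lam2 - r) / d)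
      (fun x => (lam1 - r + c1 x) / d) (fun x => (lam2 - r + c2 x) / d) y1 y2); auto.
    - lra.
    - unfold Rdiv. nra.
    - intros x Hx. specialize (Hlt x Hx). unfold Rdiv. nra. }
  lra.
Qed.

Lemma riccati_eig_decr (b d r x1 L lam1 lam2 : R) (c1 c2 : R -> R) :
  0 < d -> 0 <= x1 < L -> riccati_eig b d r x1 L lam1 c1 -> riccati_eig b d r x1 L lam2 c2 ->
  (forall x, x1 < x < L -> c1 x < c2 x) -> lam2 < lam1.
Proof.
  intros Hd Hx1 H1 H2 Hlt. destruct (Rlt_dec lam2 lam1) as [|Hn]; [assumption|].
  apply (riccati_eig_compare b d r x1 L lam2 lam1 c2 c1); auto.
  intros x Hx. specialize (Hlt x Hx). lra.
Qed.

Lemma riccati_eig_perturb (b d r x1 L lam1 lam2 e : R) (c1 c2 : R -> R) :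
  0 < d -> 0 <= x1 < L -> riccati_eig b d r x1 L lam1 c1 -> riccati_eig b d r x1 L lam2 c2 ->
  0 <= e -> (forall x, x1 < x < L -> c2 x <= c1 x + e) -> lam1 - e <= lam2.
Proof.
  intros Hd Hx1 H1 H2 He Hlt. destruct (Rle_dec (lam1 - e) lam2) as [|Hn]; [assumption|].
  enough (lam1 < lam2) by lra.
  apply (riccati_eig_compare b d r x1 L lam1 lam2 c1 c2); auto.
  intros x Hx. specialize (Hlt x Hx). lra.
Qed.

Lemma continuous_clamp_comp (f : R -> R) (u v : R) :
  u <= v -> (forall x, u <= x <= v -> continuous f x) ->
  forall x, continuous (fun t => f (clamp u v t)) x.
Proof.
  intros Huv Hf x. apply (continuous_comp (clamp u v) f).
  - apply (lipschitz_continuous _ 1). intros. rewrite Rmult_1_l. apply clamp_lipschitz.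
  - apply Hf, clamp_bounds, Huv.
Qed.

Lemma locally_open_interval (u v x : R) (P : R -> Prop) :
  u < x < v -> (forall t, u < t < v -> P t) -> locally x P.
Proof.
  intros Hx HP. assert (Hp : 0 < Rmin (x - u) (v - x)) by (apply Rmin_glb_lt; lra).
  exists (mkposreal _ Hp). intros t Ht. apply HP.
  apply Rabs_def2 in Ht. unfold minus, plus, opp in Ht; simpl in Ht.
  pose proof (Rmin_l (x - u) (v - x)). pose proof (Rmin_r (x - u) (v - x)). lra.
Qed.

(* The logarithmic derivative of [exp (b x / 2) * cos (k x - e)]. *)
Definition tan_profile (b k e x : R) : R := b / 2 - k * tan (k * x - e).

Lemma is_derive_tan_profile (b k e x : R) :
  - (PI / 2) < k * x - e < PI / 2 ->
  is_derive (tan_profile b k e) x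
    (- tan_profile b k e x ^ 2 + b * tan_profile b k e x + (- k ^ 2 - b ^ 2 / 4)).
Proof.
  intros Hr.
  assert (Hcos : cos (k * x - e) <> 0) by (apply Rgt_not_eq, cos_gt_0; lra).
  replace (- tan_profile b k e x ^ 2 + b * tan_profile b k e x + (- k ^ 2 - b ^ 2 / 4))
    with (0 - k * (k * (tan (k * x - e) ^ 2 + 1))) by (unfold tan_profile; field).
  unfold tan_profile.
  apply (is_derive_minus (fun _ => b / 2) (fun x => k * tan (k * x - e))).
  - apply (is_derive_const (b / 2)).
  - apply (is_derive_scal (fun x => tan (k * x - e))).
    apply (is_derive_comp tan (fun x => k * x - e)).
    + apply is_derive_tan, Hcos.
    + auto_derive; [exact I|ring].
Qed.

Lemma tan_profile_continuous (b k e x : R) :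
  - (PI / 2) < k * x - e < PI / 2 -> continuous (tan_profile b k e) x.
Proof.
  intros H. apply (ex_derive_continuous (tan_profile b k e)). eexists.
  apply is_derive_tan_profile, H.
Qed.

Lemma tan_cofunction_atan (t : R) : 0 < t -> tan (PI / 2 - atan t) = / t.
Proof.
  intros Ht. pose proof (atan_bound t) as Hb.
  assert (Hc : 0 < cos (atan t)) by (apply cos_gt_0; lra).
  assert (Hs : 0 < sin (atan t)).
  { apply sin_gt_0; [|pose proof PI_RGT_0; lra].
    rewrite <- atan_0. apply atan_increasing, Ht. }
  rewrite <- (tan_atan t) at 2. unfold tan. rewrite sin_shift, cos_shift. field. lra.
Qed.

Lemma discriminant_pos (d r a : R) : 0 < d -> 0 < r -> 0 < a -> a < sqrt (4 * d * r) ->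
  0 < 4 * d * r - a ^ 2.
Proof.
  intros Hd Hr Ha H.
  assert (Hdr : 0 <= 4 * d * r) by (apply Rmult_le_pos; nra).
  pose proof (sqrt_sqrt _ Hdr). nra.
Qed.

(* The three branches of [L1star] are one expression, by the double-angle formula. *)
Lemma L1star_eq (d r a : R) : 0 < d -> 0 < r -> 0 < a -> a < sqrt (4 * d * r) ->
  L1star d r a = 2 * d * (PI - 2 * atan (sqrt (4 * d * r - a ^ 2) / a))
                 / sqrt (4 * d * r - a ^ 2).
Proof.
  intros Hd Hr Ha H.
  pose proof (discriminant_pos d r a Hd Hr Ha H) as HD2.
  unfold L1star. set (D := sqrt (4 * d * r - a ^ 2)).
  assert (HD : 0 < D) by (apply sqrt_lt_R0, HD2).
  assert (HDD : D * D = 4 * d * r - a ^ 2) by (apply sqrt_sqrt; lra).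
  assert (Hdr : 0 <= 2 * d * r) by (apply Rmult_le_pos; nra).
  pose proof (sqrt_sqrt _ Hdr) as Hss. pose proof (sqrt_pos (2 * d * r)) as Hsp.
  set (th := atan (D / a)).
  assert (HDa : 0 < D / a) by (apply Rdiv_lt_0_compat; lra).
  assert (Hth : 0 < th < PI / 2).
  { split; [|apply atan_bound]. unfold th. rewrite <- atan_0. apply atan_increasing, HDa. }
  assert (Htan : tan th = D / a) by apply tan_atan.
  assert (Hct : 0 < cos th) by (apply cos_gt_0; lra).
  assert (Hquarter : atan 1 = PI / 4) by apply atan_1.
  assert (Hst : sin th = D / a * cos th).
  { rewrite <- Htan. unfold tan. field. lra. }
  assert (Hsc := sin2_cos2 th). unfold Rsqr in Hsc.
  assert (Hfrac : a <> D -> a * D / (2 * d * r - a ^ 2) = - tan (2 * th)).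
  { intros Hne.
    assert (Hne2 : D * D - a * a <> 0).
    { intros E. apply Hne. nra. }
    assert (Hc2 : cos (2 * th) = (a * a - D * D) / (a * a) * (cos th * cos th)).
    { rewrite cos_2a, Hst. field. lra. }
    assert (Hs2 : sin (2 * th) = 2 * (D / a) * (cos th * cos th)).
    { rewrite sin_2a, Hst. ring. }
    unfold tan. rewrite Hc2, Hs2.
    replace (2 * d * r - a ^ 2) with ((D * D - a * a) / 2) by nra.
    field. repeat split; try lra. }
  destruct (total_order_T a (sqrt (2 * d * r))) as [[Hlt|Heq]|Hgt].
  - assert (HaD : a < D) by nra.
    assert (Hth4 : PI / 4 < th).
    { unfold th. rewrite <- Hquarter. apply atan_increasing.
      apply Rmult_lt_reg_r with a; [exact Ha|]. unfold Rdiv.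
      rewrite Rmult_assoc, Rinv_l; lra. }
    rewrite Hfrac by lra. rewrite <- Rtrigo_facts.tan_pi_minus.
    + rewrite atan_tan by lra. reflexivity.
    + apply Rlt_not_eq, cos_lt_0; lra.
  - assert (HaD : a = D) by nra.
    assert (Hth4 : th = PI / 4).
    { unfold th. rewrite <- HaD. replace (a / a) with 1 by (field; lra). exact Hquarter. }
    rewrite Hth4. f_equal. f_equal. lra.
  - assert (HaD : D < a) by nra.
    assert (Hth4 : th < PI / 4).
    { unfold th. rewrite <- Hquarter. apply atan_increasing.
      apply Rmult_lt_reg_r with a; [exact Ha|]. unfold Rdiv.
      rewrite Rmult_assoc, Rinv_l; lra. }
    rewrite Hfrac by lra. rewrite <- tan_neg, atan_tan by lra.
    reflexivity.
Qed.

Lemma critical_wavenumber (d r a : R) :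
  0 < d -> 0 < 4 * d * r - a ^ 2 ->
  (sqrt (4 * d * r - a ^ 2) / (2 * d)) ^ 2 = r / d - (a / d) ^ 2 / 4.
Proof.
  intros Hd HD2. pose proof (sqrt_sqrt (4 * d * r - a ^ 2) ltac:(lra)) as HDD.
  replace ((sqrt (4 * d * r - a ^ 2) / (2 * d)) ^ 2)
    with (sqrt (4 * d * r - a ^ 2) * sqrt (4 * d * r - a ^ 2) / (4 * d ^ 2)) by (field; lra).
  rewrite HDD. field. lra.
Qed.

(* For [L > L1star] the eigenvalue of the unperturbed problem is [d (k0^2 - k^2)], where [k]
   is the first wave number compatible with the boundary conditions and [k < k0]. *)
Lemma riccati_eig_pos_of_small (d r a x1 L : R) :
  0 < d -> 0 < r -> 0 < a -> a < sqrt (4 * d * r) -> 0 <= x1 < L -> L1star d r a < L ->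
  exists eps, 0 < eps /\ forall c lam, (forall x, x1 < x < L -> c x <= eps) ->
    riccati_eig (a / d) d r x1 L lam c -> 0 < lam.
Proof.
  intros Hd Hr Ha Had Hx1 HL.
  pose proof (discriminant_pos d r a Hd Hr Ha Had) as HD2.
  rewrite L1star_eq in HL by assumption.
  pose proof (critical_wavenumber d r a Hd HD2) as Hk0.
  set (D := sqrt (4 * d * r - a ^ 2)) in *.
  assert (HD : 0 < D) by (apply sqrt_lt_R0, HD2).
  set (k0 := D / (2 * d)) in *. set (b := a / d) in *.
  assert (Hk0p : 0 < k0) by (apply Rdiv_lt_0_compat; lra).
  assert (Hb : 0 < b) by (apply Rdiv_lt_0_compat; lra).
  assert (HLk : PI - 2 * atan (2 * k0 / b) < k0 * L).
  { replace (2 * k0 / b) with (D / a) by (unfold k0, b; field; lra).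
    apply Rmult_lt_compat_l with (r := k0) in HL; [|exact Hk0p].
    replace (k0 * (2 * d * (PI - 2 * atan (D / a)) / D)) with (PI - 2 * atan (D / a)) in HL
      by (unfold k0; field; lra). exact HL. }
  pose proof PI_RGT_0 as HPI.
  destruct (IVT_gen (fun k => k * L - PI + 2 * atan (2 * k / b)) 0 k0 0) as [k [Hk Hfk]].
  { intros k. apply continuity_pt_filterlim.
    apply (ex_derive_continuous (fun k => k * L - PI + 2 * atan (2 * k / b))).
    auto_derive. lra. }
  { replace (2 * 0 / b) with 0 by (field; lra). rewrite atan_0.
    rewrite Rmin_left, Rmax_right; lra. }
  rewrite Rmin_left, Rmax_right in Hk by lra.
  assert (Hkp : 0 < k).
  { destruct (proj1 Hk) as [|<-]; [assumption|].
    replace (2 * 0 / b) with 0 in Hfk by (field; lra). rewrite atan_0 in Hfk. lra. }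
  assert (Hkk0 : k < k0).
  { destruct (proj2 Hk) as [|Heq]; [assumption|]. rewrite Heq in Hfk. lra. }
  set (e := k * L / 2).
  assert (He : e = PI / 2 - atan (2 * k / b)) by (unfold e; lra).
  assert (Hkb : 0 < 2 * k / b) by (apply Rdiv_lt_0_compat; lra).
  assert (Hte : k * tan e = b / 2).
  { rewrite He, tan_cofunction_atan by exact Hkb. field. lra. }
  assert (Her : 0 < e < PI / 2).
  { pose proof (atan_bound (2 * k / b)). split; [unfold e; nra|].
    rewrite He. pose proof (atan_increasing 0 _ Hkb) as H0. rewrite atan_0 in H0. lra. }
  assert (Hrange : forall x, 0 <= x <= L -> - (PI / 2) < k * x - e < PI / 2).
  { intros x Hx. unfold e in *. nra. }
  set (lam0 := d * (k0 ^ 2 - k ^ 2)).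
  assert (Hlam0 : 0 < lam0) by (apply Rmult_lt_0_compat; nra).
  assert (Hrho : - k ^ 2 - b ^ 2 / 4 = (lam0 - r) / d).
  { unfold lam0. rewrite Hk0. field. lra. }
  exists (lam0 / 2). split; [lra|]. intros c lam Hc [y [Cy [Y0 [YL [YP YQ]]]]].
  destruct (Rlt_dec 0 lam) as [|Hn]; [assumption|exfalso].
  assert (Hid : 0 < / d) by (apply Rinv_0_lt_compat, Hd).
  set (Q := fun x => tan_profile b k e (clamp 0 L x)).
  assert (HQd : forall x, 0 < x < L -> is_derive Q x (- Q x ^ 2 + b * Q x + (lam0 - r) / d)).
  { intros x Hx. rewrite <- Hrho. unfold Q at 2 3. rewrite clamp_id by lra.
    apply (is_derive_ext_loc (tan_profile b k e)).
    - apply (locally_open_interval 0 L x); [exact Hx|]. intros t Ht. unfold Q.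
      rewrite clamp_id by lra. reflexivity.
    - apply is_derive_tan_profile, Hrange. lra. }
  assert (H : y L < Q L).
  { apply (riccati_compare b x1 L ((lam0 - r) / d) ((lam - r) / d)
      (fun x => (lam0 - r) / d) (fun x => (lam - r + c x) / d) Q y); auto.
    - apply continuous_clamp_comp; [lra|]. intros x Hx.
      apply tan_profile_continuous, Hrange, Hx.
    - rewrite Y0. unfold Q, tan_profile. rewrite clamp_id by lra.
      replace (k * 0 - e) with (- e) by ring. rewrite tan_neg. lra.
    - intros x Hx. apply HQd. lra.
    - intros x Hx. apply HQd. lra.
    - unfold Rdiv. nra.
    - intros x Hx. specialize (Hc x Hx). unfold Rdiv. nra. }
  assert (HQL : Q L = 0).
  { unfold Q, tan_profile. rewrite clamp_id by lra.
    replace (k * L - e) with e by (unfold e; field). lra. }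
  lra.
Qed.

(* The supersolution follows the unperturbed equation on [0, x1], where [x1 < Lstar] keeps it
   finite, and then is affine and reaches a nonnegative value at [L]. *)
Lemma riccati_eig_neg_of_large (d r a x1 L : R) :
  0 < d -> 0 < r -> 0 < a -> a < sqrt (4 * d * r) -> 0 <= x1 < L -> x1 < Lstar d r a ->
  exists K, 0 < K /\ forall c lam, (forall x, x1 < x < L -> K <= c x) ->
    riccati_eig (a / d) d r x1 L lam c -> lam < 0.
Proof.
  intros Hd Hr Ha Had Hx1 HL.
  pose proof (discriminant_pos d r a Hd Hr Ha Had) as HD2.
  pose proof (critical_wavenumber d r a Hd HD2) as Hk.
  unfold Lstar in HL. set (D := sqrt (4 * d * r - a ^ 2)) in *.
  assert (HD : 0 < D) by (apply sqrt_lt_R0, HD2).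
  set (k := D / (2 * d)) in *. set (b := a / d) in *.
  assert (Hkp : 0 < k) by (apply Rdiv_lt_0_compat; lra).
  assert (Hb : 0 < b) by (apply Rdiv_lt_0_compat; lra).
  pose proof PI_RGT_0 as HPI.
  set (e := PI / 2 - atan (2 * k / b)).
  assert (Hkb : 0 < 2 * k / b) by (apply Rdiv_lt_0_compat; lra).
  assert (Hte : k * tan e = b / 2).
  { unfold e. rewrite tan_cofunction_atan by exact Hkb. field. lra. }
  assert (Her : 0 < e < PI / 2).
  { pose proof (atan_bound (2 * k / b)). unfold e.
    pose proof (atan_increasing 0 _ Hkb) as H0. rewrite atan_0 in H0. lra. }
  assert (Hkx1 : k * x1 - e < PI / 2).
  { unfold e. replace (2 * k / b) with (D / a) by (unfold k, b; field; lra).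
    apply Rmult_lt_compat_l with (r := k) in HL; [|exact Hkp].
    replace (k * (2 * d * (PI - atan (D / a)) / D)) with (PI - atan (D / a)) in HL
      by (unfold k; field; lra). lra. }
  assert (Hrange : forall x, 0 <= x <= x1 -> - (PI / 2) < k * x - e < PI / 2).
  { intros x Hx. nra. }
  assert (Hrho : - k ^ 2 - b ^ 2 / 4 = - r / d) by (rewrite Hk; field; lra).
  set (q1 := tan_profile b k e x1). set (s := Rabs q1 / (L - x1)).
  assert (Hs : 0 <= s) by (apply Rdiv_le_0_compat; [apply Rabs_pos|lra]).
  assert (HsL : s * (L - x1) = Rabs q1) by (unfold s; field; lra).
  set (M := 2 * Rabs q1).
  set (Q := fun x => tan_profile b k e (clamp 0 x1 x) + s * (Rmax x1 x - x1)).
  assert (HQ2 : forall x, x1 <= x -> Q x = q1 + s * (x - x1)).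
  { intros x Hx. unfold Q, clamp. rewrite Rmin_left, !Rmax_right by lra. reflexivity. }
  assert (HQb : forall x, x1 <= x <= L -> - M <= Q x <= M).
  { intros x Hx. rewrite HQ2 by lra.
    assert (0 <= s * (x - x1) <= Rabs q1) by (rewrite <- HsL; nra).
    pose proof (Rle_abs q1). pose proof (Rle_abs (- q1)) as Hq. rewrite Rabs_Ropp in Hq.
    unfold M. lra. }
  assert (HM : 0 <= M) by (unfold M; pose proof (Rabs_pos q1); lra).
  assert (HbM : 0 <= b * M) by (apply Rmult_le_pos; lra).
  exists (r + d * (1 + s + M ^ 2 + b * M)). split; [nra|].
  intros c lam Hc [y [Cy [Y0 [YL [YP YQ]]]]].
  destruct (Rlt_dec lam 0) as [|Hn]; [assumption|exfalso].
  assert (Hid : 0 < / d) by (apply Rinv_0_lt_compat, Hd).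
  assert (H : Q L < y L).
  { apply (riccati_compare b x1 L ((lam - r) / d) (- r / d)
      (fun x => (lam - r + c x) / d) (fun x => s + Q x ^ 2 - b * Q x) y Q); auto.
    - intros x. apply (continuous_plus (fun x => tan_profile b k e (clamp 0 x1 x))
        (fun x => s * (Rmax x1 x - x1))).
      + apply continuous_clamp_comp; [lra|]. intros t Ht.
        apply tan_profile_continuous, Hrange, Ht.
      + apply (continuous_comp (Rmax x1) (fun t => s * (t - x1))); [apply continuous_Rmax|].
        apply (ex_derive_continuous (fun t => s * (t - x1))). auto_derive. exact I.
    - rewrite Y0. unfold Q, tan_profile. rewrite clamp_id, Rmax_left by lra.
      replace (k * 0 - e) with (- e) by ring. rewrite tan_neg. lra.
    - intros x Hx. rewrite <- Hrho.
      assert (HQ1 : forall t, 0 < t < x1 -> tan_profile b k e t = Q t).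
      { intros t Ht. unfold Q. rewrite clamp_id, Rmax_left by lra. ring. }
      rewrite <- HQ1 by exact Hx.
      apply (is_derive_ext_loc (tan_profile b k e)).
      + apply (locally_open_interval 0 x1 x); assumption.
      + apply is_derive_tan_profile, Hrange. lra.
    - intros x Hx. replace (- Q x ^ 2 + b * Q x + (s + Q x ^ 2 - b * Q x)) with s by ring.
      apply (is_derive_ext_loc (fun x => q1 + s * (x - x1))).
      + apply (locally_open_interval x1 L x); [exact Hx|]. intros t Ht. symmetry.
        apply HQ2. lra.
      + auto_derive; [exact I|ring].
    - unfold Rdiv. nra.
    - intros x Hx. specialize (Hc x Hx). specialize (HQb x ltac:(lra)).
      apply Rlt_le_trans with (1 + s + M ^ 2 + b * M).
      + assert (Q x ^ 2 <= M ^ 2) by nra. assert (- (b * Q x) <= b * M) by nra. lra.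
      + apply Rmult_le_reg_r with d; [exact Hd|]. unfold Rdiv.
        rewrite Rmult_assoc, Rinv_l by lra. nra. }
  assert (HQL : 0 <= Q L).
  { rewrite HQ2, HsL by lra. pose proof (Rle_abs (- q1)) as Hq. rewrite Rabs_Ropp in Hq. lra. }
  lra.
Qed.

Lemma continuous_pos_bounds (c : R -> R) (u v : R) :
  u <= v -> (forall x, continuous c x) -> (forall x, u <= x <= v -> 0 < c x) ->
  exists lo hi, 0 < lo /\ 0 < hi /\ forall x, u <= x <= v -> lo <= c x <= hi.
Proof.
  intros Huv Hc Hp.
  assert (Hc' : forall x, u <= x <= v -> continuity_pt c x).
  { intros x _. apply continuity_pt_filterlim, Hc. }
  destruct (continuity_ab_min c u v Huv Hc') as [m [Hm1 Hm2]].
  destruct (continuity_ab_maj c u v Huv Hc') as [M [HM1 HM2]].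
  exists (c m), (c M). repeat split; auto.
Qed.

Lemma continuous_scal_fun (M : R) (c : R -> R) :
  (forall x, continuous c x) -> forall x, continuous (fun t => M * c t) x.
Proof.
  intros Hc x. apply (continuous_comp c (fun t => M * t)); [apply Hc|apply continuous_lin].
Qed.

Lemma critical_amplitude (b d r x1 L eps K : R) (c : R -> R) :
  0 < b -> 0 < d -> 0 <= x1 < L -> 0 < eps -> 0 < K ->
  (forall c lam, (forall x, x1 < x < L -> c x <= eps) ->
     riccati_eig b d r x1 L lam c -> 0 < lam) ->
  (forall c lam, (forall x, x1 < x < L -> K <= c x) ->
     riccati_eig b d r x1 L lam c -> lam < 0) ->
  (forall x, continuous c x) -> (forall x, x1 <= x <= L -> 0 < c x) ->
  exists Ms, 0 < Ms /\ forall M, 0 < M ->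
    exists lam, riccati_eig b d r x1 L lam (fun x => M * c x) /\
      (M < Ms -> 0 < lam) /\ (Ms < M -> lam < 0) /\ (M = Ms -> lam = 0).
Proof.
  intros Hb Hd Hx1 Heps HK Hsmall Hlarge Hc Hp.
  destruct (continuous_pos_bounds c x1 L ltac:(lra) Hc Hp) as [lo [hi [Hlo [Hhi Hbd]]]].
  set (eig := fun M lam => riccati_eig b d r x1 L lam (fun x => M * c x)).
  assert (Hex : forall M, 0 < M -> exists lam, eig M lam).
  { intros M HM. apply (riccati_eig_exists b d r x1 L (M * hi)); auto.
    - apply continuous_scal_fun, Hc.
    - intros x Hx. specialize (Hbd x Hx). split; nra. }
  assert (Hdecr : forall M1 M2 l1 l2, M1 < M2 -> eig M1 l1 -> eig M2 l2 -> l2 < l1).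
  { intros M1 M2 l1 l2 HM H1 H2.
    apply (riccati_eig_decr b d r x1 L l1 l2 _ _ Hd Hx1 H1 H2).
    intros x Hx. apply Rmult_lt_compat_r; [apply Hp; lra|exact HM]. }
  assert (Hpert : forall M1 M2 l1 l2, M1 <= M2 -> eig M1 l1 -> eig M2 l2 ->
            l1 - (M2 - M1) * hi <= l2).
  { intros M1 M2 l1 l2 HM H1 H2.
    apply (riccati_eig_perturb b d r x1 L l1 l2 _ _ _ Hd Hx1 H1 H2); [nra|].
    intros x Hx. specialize (Hbd x ltac:(lra)). nra. }
  set (E := fun M => 0 < M /\ exists lam, 0 <= lam /\ eig M lam).
  assert (HE0 : E (eps / hi)).
  { assert (Hq : 0 < eps / hi) by (apply Rdiv_lt_0_compat; lra).
    split; [exact Hq|]. destruct (Hex _ Hq) as [lam Hlam]. exists lam. split; [|exact Hlam].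
    left. apply (Hsmall (fun x => eps / hi * c x)); [|exact Hlam].
    intros x Hx. specialize (Hbd x ltac:(lra)).
    apply Rle_trans with (eps / hi * hi); [nra|]. right. field. lra. }
  destruct (completeness E) as [Ms [Hub Hlub]].
  - exists (K / lo). intros M [HM [lam [Hl0 Hlam]]].
    destruct (Rle_dec M (K / lo)) as [|Hn]; [assumption|exfalso].
    enough (lam < 0) by lra. apply (Hlarge (fun x => M * c x)); [|exact Hlam].
    intros x Hx. specialize (Hbd x ltac:(lra)).
    apply Rle_trans with (K / lo * lo); [right; field; lra|].
    assert (0 < K / lo) by (apply Rdiv_lt_0_compat; lra). nra.
  - exists (eps / hi). exact HE0.
  - assert (HMs : 0 < Ms).
    { apply Rlt_le_trans with (eps / hi); [apply Rdiv_lt_0_compat; lra|apply Hub, HE0]. }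
    assert (Hbelow : forall M lam, 0 < M -> eig M lam -> M < Ms -> 0 < lam).
    { intros M lam HM Hlam HMMs. destruct (Rlt_dec 0 lam) as [|Hn]; [assumption|exfalso].
      assert (Ms <= M); [|lra]. apply Hlub. intros M' [HM' [lam' [Hl0 Hlam']]].
      destruct (Rle_dec M' M) as [|Hn']; [assumption|].
      pose proof (Hdecr M M' lam lam' ltac:(lra) Hlam Hlam'). lra. }
    assert (Habove : forall M lam, 0 < M -> eig M lam -> Ms < M -> lam < 0).
    { intros M lam HM Hlam HMMs. destruct (Rlt_dec lam 0) as [|Hn]; [assumption|exfalso].
      assert (M <= Ms); [|lra]. apply Hub. split; [exact HM|]. exists lam. split; [lra|exact Hlam]. }
    exists Ms. split; [exact HMs|]. intros M HM. destruct (Hex M HM) as [lam Hlam].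
    exists lam. split; [exact Hlam|]. split; [apply Hbelow; assumption|].
    split; [apply Habove; assumption|]. intros ->.
    destruct (Rtotal_order lam 0) as [Hneg|[Hz|Hpos]]; [exfalso|exact Hz|exfalso].
    + set (t := Rmin (Ms / 2) (- lam / (2 * hi))).
      assert (Ht : 0 < t) by (apply Rmin_glb_lt; [lra|apply Rdiv_lt_0_compat; lra]).
      assert (Ht1 : t <= Ms / 2) by apply Rmin_l.
      assert (Ht2 : t * hi <= - lam / 2).
      { apply Rle_trans with (- lam / (2 * hi) * hi); [|right; field; lra].
        apply Rmult_le_compat_r; [lra|apply Rmin_r]. }
      destruct (Hex (Ms - t) ltac:(lra)) as [l Hl].
      pose proof (Hbelow (Ms - t) l ltac:(lra) Hl ltac:(lra)) as H.
      pose proof (Hpert (Ms - t) Ms l lam ltac:(lra) Hl Hlam) as H0.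
      replace ((Ms - (Ms - t)) * hi) with (t * hi) in H0 by ring. lra.
    + set (t := lam / (2 * hi)).
      assert (Ht : 0 < t) by (apply Rdiv_lt_0_compat; lra).
      assert (Ht2 : t * hi = lam / 2) by (unfold t; field; lra).
      destruct (Hex (Ms + t) ltac:(lra)) as [l Hl].
      pose proof (Habove (Ms + t) l ltac:(lra) Hl ltac:(lra)) as H.
      pose proof (Hpert Ms (Ms + t) lam l ltac:(lra) Hlam Hl) as H0.
      replace ((Ms + t - Ms) * hi) with (t * hi) in H0 by ring. lra.
Qed.

(** * The steady state of the toxin *)

Lemma derive_neg_local (f : R -> R) (x l : R) :
  is_derive f x l -> l < 0 ->
  exists de, 0 < de /\ (forall y, x < y < x + de -> f y < f x) /\
    (forall y, x - de < y < x -> f x < f y).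
Proof.
  intros Hf Hl. apply is_derive_Reals in Hf.
  destruct (Hf (- l) ltac:(lra)) as [de Hde]. exists de. split; [apply cond_pos|].
  assert (H : forall h, h <> 0 -> Rabs h < de -> (f (x + h) - f x) / h < 0).
  { intros h Hh Hhd. specialize (Hde h Hh Hhd). apply Rabs_def2 in Hde. lra. }
  split; intros y Hy.
  - specialize (H (y - x) ltac:(lra) ltac:(apply Rabs_def1; lra)).
    replace (x + (y - x)) with y in H by ring.
    apply (Rmult_lt_compat_r (y - x)) in H; [|lra].
    replace ((f y - f x) / (y - x) * (y - x)) with (f y - f x) in H by (field; lra). lra.
  - specialize (H (y - x) ltac:(lra) ltac:(apply Rabs_def1; lra)).
    replace (x + (y - x)) with y in H by ring.
    apply (Rmult_lt_compat_r (x - y)) in H; [|lra].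
    replace ((f y - f x) / (y - x) * (x - y)) with (f x - f y) in H by (field; lra). lra.
Qed.

Lemma min_point_derivatives (z z1 z2 : R -> R) (u v t : R) :
  u < v -> (forall x, is_derive z x (z1 x)) -> (forall x, is_derive z1 x (z2 x)) ->
  u <= t <= v -> (forall x, u <= x <= v -> z t <= z x) ->
  (t = u -> z1 t <= 0) -> (t = v -> 0 <= z1 t) -> z1 t = 0 /\ 0 <= z2 t.
Proof.
  intros Huv H1 H2 Ht Hmin Hu Hv.
  assert (Hcz : forall x, continuous z x).
  { intros x. apply (ex_derive_continuous z). exists (z1 x). apply H1. }
  assert (Hnn : 0 <= z1 t).
  { destruct (Req_dec t v) as [E|E]; [auto|].
    destruct (Rle_dec 0 (z1 t)) as [|Hn]; [assumption|exfalso].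
    destruct (derive_neg_local z t (z1 t) (H1 t) ltac:(lra)) as [de [Hde [Hr _]]].
    set (y := t + Rmin (de / 2) (v - t)).
    assert (0 < Rmin (de / 2) (v - t)) by (apply Rmin_glb_lt; lra).
    pose proof (Rmin_l (de / 2) (v - t)). pose proof (Rmin_r (de / 2) (v - t)).
    specialize (Hr y ltac:(unfold y; lra)). specialize (Hmin y ltac:(unfold y; lra)). lra. }
  assert (Hnp : z1 t <= 0).
  { destruct (Req_dec t u) as [E|E]; [auto|].
    destruct (Rle_dec (z1 t) 0) as [|Hn]; [assumption|exfalso].
    destruct (derive_neg_local (fun x => - z x) t (- z1 t)) as [de [Hde [_ Hl]]].
    { apply (is_derive_opp z), H1. }
    { lra. }
    set (y := t - Rmin (de / 2) (t - u)).
    assert (0 < Rmin (de / 2) (t - u)) by (apply Rmin_glb_lt; lra).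
    pose proof (Rmin_l (de / 2) (t - u)). pose proof (Rmin_r (de / 2) (t - u)).
    specialize (Hl y ltac:(unfold y; lra)). specialize (Hmin y ltac:(unfold y; lra)). lra. }
  assert (Hz : z1 t = 0) by lra. split; [exact Hz|].
  destruct (Rle_dec 0 (z2 t)) as [|Hn]; [assumption|exfalso].
  destruct (derive_neg_local z1 t (z2 t) (H2 t) ltac:(lra)) as [de [Hde [Hr Hl]]].
  destruct (Req_dec t v) as [E|E].
  - set (y := t - Rmin (de / 2) (t - u)).
    assert (0 < Rmin (de / 2) (t - u)) by (apply Rmin_glb_lt; lra).
    pose proof (Rmin_l (de / 2) (t - u)). pose proof (Rmin_r (de / 2) (t - u)).
    assert (z y < z t).
    { apply (derive_pos_lt z z1); auto; [unfold y; lra|].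
      intros x Hx. specialize (Hl x ltac:(unfold y in Hx; lra)). lra. }
    specialize (Hmin y ltac:(unfold y; lra)). lra.
  - set (y := t + Rmin (de / 2) (v - t)).
    assert (0 < Rmin (de / 2) (v - t)) by (apply Rmin_glb_lt; lra).
    pose proof (Rmin_l (de / 2) (v - t)). pose proof (Rmin_r (de / 2) (v - t)).
    assert (- z t < - z y).
    { apply (derive_pos_lt (fun x => - z x) (fun x => - z1 x)); [unfold y; lra| | |].
      - intros x. apply (continuous_opp z), Hcz.
      - intros x _. apply (is_derive_opp z), H1.
      - intros x Hx. specialize (Hr x ltac:(unfold y in Hx; lra)). lra. }
    specialize (Hmin y ltac:(unfold y; lra)). lra.
Qed.

Lemma max_principle (d a q x1 L : R) (z z1 z2 : R -> R) :
  0 < d -> 0 <= a -> 0 < q -> x1 < L ->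
  (forall x, is_derive z x (z1 x)) -> (forall x, is_derive z1 x (z2 x)) ->
  (forall x, x1 <= x <= L -> d * z2 x - a * z1 x - q * z x <= 0) ->
  d * z1 x1 - a * z x1 <= 0 -> 0 <= z1 L ->
  (forall x, x1 <= x <= L -> 0 <= z x) /\
  (forall x, x1 <= x <= L -> d * z2 x - a * z1 x - q * z x < 0 -> 0 < z x).
Proof.
  intros Hd Ha Hq HxL H1 H2 Hop Hb1 HbL.
  assert (Hmp : forall t, x1 <= t <= L -> (forall x, x1 <= x <= L -> z t <= z x) -> z t <= 0 ->
            - q * z t <= d * z2 t - a * z1 t - q * z t).
  { intros t Ht Hmin Hneg.
    destruct (min_point_derivatives z z1 z2 x1 L t HxL H1 H2 Ht Hmin) as [E1 E2].
    - intros ->. nra.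
    - intros ->. exact HbL.
    - rewrite E1. nra. }
  assert (Hnn : forall x, x1 <= x <= L -> 0 <= z x).
  { destruct (continuity_ab_min z x1 L ltac:(lra)) as [t [Hmin Ht]].
    { intros x _. apply continuity_pt_filterlim.
      apply (ex_derive_continuous z). exists (z1 x). apply H1. }
    intros x Hx. apply Rle_trans with (z t); [|apply Hmin, Hx].
    destruct (Rle_dec 0 (z t)) as [|Hn]; [assumption|exfalso].
    specialize (Hmp t Ht Hmin ltac:(lra)). specialize (Hop t Ht). nra. }
  split; [exact Hnn|]. intros x Hx Hlt.
  destruct (Rlt_dec 0 (z x)) as [|Hn]; [assumption|exfalso].
  pose proof (Hnn x Hx). assert (E : z x = 0) by lra.
  specialize (Hmp x Hx ltac:(intros y Hy; rewrite E; apply Hnn, Hy) ltac:(lra)).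
  rewrite E in *. lra.
Qed.

Definition root_pos (d a q : R) : R := (a + sqrt (a ^ 2 + 4 * d * q)) / (2 * d).
Definition root_neg (d a q : R) : R := (a - sqrt (a ^ 2 + 4 * d * q)) / (2 * d).

Lemma roots_spec (d a q : R) : 0 < d -> 0 <= a -> 0 < q ->
  0 < root_pos d a q /\ root_neg d a q < 0 /\ d * (root_pos d a q + root_neg d a q) = a /\
  d * root_pos d a q ^ 2 = a * root_pos d a q + q /\
  d * root_neg d a q ^ 2 = a * root_neg d a q + q.
Proof.
  intros Hd Ha Hq. unfold root_pos, root_neg.
  assert (Hdq : 0 < d * q) by (apply Rmult_lt_0_compat; assumption).
  assert (Hp : 0 < a ^ 2 + 4 * d * q) by nra.
  pose proof (sqrt_sqrt _ (Rlt_le _ _ Hp)) as Hs. pose proof (sqrt_lt_R0 _ Hp) as Hs0.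
  set (s := sqrt (a ^ 2 + 4 * d * q)) in *.
  assert (Has : a < s) by nra.
  assert (Hid : 0 < / (2 * d)) by (apply Rinv_0_lt_compat; lra).
  repeat split.
  - apply Rmult_lt_0_compat; lra.
  - unfold Rdiv. nra.
  - field; lra.
  - replace (d * ((a + s) / (2 * d)) ^ 2) with ((a * a + 2 * a * s + s * s) / (4 * d))
      by (field; lra). rewrite Hs. field. lra.
  - replace (d * ((a - s) / (2 * d)) ^ 2) with ((a * a - 2 * a * s + s * s) / (4 * d))
      by (field; lra). rewrite Hs. field. lra.
Qed.

Definition toxin_coef (d a q x1 L : R) : R :=
  a / q / (d * (root_pos d a q ^ 2 * exp (root_pos d a q * (L - x1))
                - root_neg d a q ^ 2 * exp (root_neg d a q * (L - x1)))).

(* The steady state of the second equation for [h = 1]. *)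
Definition toxin (d a q x1 L x : R) : R :=
  / q + toxin_coef d a q x1 L *
    (root_neg d a q * exp (root_neg d a q * (L - x1) + root_pos d a q * (x - x1))
     - root_pos d a q * exp (root_pos d a q * (L - x1) + root_neg d a q * (x - x1))).

Definition toxin' (d a q x1 L x : R) : R :=
  toxin_coef d a q x1 L * (root_pos d a q * root_neg d a q) *
    (exp (root_neg d a q * (L - x1) + root_pos d a q * (x - x1))
     - exp (root_pos d a q * (L - x1) + root_neg d a q * (x - x1))).

Definition toxin'' (d a q x1 L x : R) : R :=
  (a * toxin' d a q x1 L x + q * toxin d a q x1 L x - 1) / d.

Lemma toxin_coef_denom (d a q x1 L : R) : 0 < d -> 0 <= a -> 0 < q -> x1 < L ->
  0 < d * (root_pos d a q ^ 2 * exp (root_pos d a q * (L - x1))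
           - root_neg d a q ^ 2 * exp (root_neg d a q * (L - x1))).
Proof.
  intros Hd Ha Hq HxL. destruct (roots_spec d a q Hd Ha Hq) as [Hp [Hn [Hs _]]].
  set (p := root_pos d a q) in *. set (n := root_neg d a q) in *.
  apply Rmult_lt_0_compat; [exact Hd|].
  assert (He : exp (n * (L - x1)) < exp (p * (L - x1))) by (apply exp_increasing; nra).
  pose proof (exp_pos (n * (L - x1))).
  assert (Hpn : 0 <= p + n).
  { apply Rmult_le_reg_l with d; [exact Hd|]. lra. }
  assert (Hsq : 0 <= (p - n) * (p + n)) by (apply Rmult_le_pos; lra).
  assert (Hp2 : 0 < p ^ 2) by (apply pow_lt, Hp).
  assert (Hlt : p ^ 2 * exp (n * (L - x1)) < p ^ 2 * exp (p * (L - x1)))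
    by (apply Rmult_lt_compat_l; assumption).
  assert (Hle : n ^ 2 * exp (n * (L - x1)) <= p ^ 2 * exp (n * (L - x1)))
    by (apply Rmult_le_compat_r; lra).
  lra.
Qed.

Lemma toxin_coef_nonneg (d a q x1 L : R) : 0 < d -> 0 <= a -> 0 < q -> x1 < L ->
  0 <= toxin_coef d a q x1 L.
Proof.
  intros. apply Rdiv_le_0_compat; [apply Rdiv_le_0_compat; lra|].
  apply toxin_coef_denom; assumption.
Qed.

Lemma is_derive_toxin (d a q x1 L x : R) : is_derive (toxin d a q x1 L) x (toxin' d a q x1 L x).
Proof. unfold toxin, toxin'. auto_derive; [exact I|]. unfold Rminus. ring. Qed.

Lemma is_derive_toxin' (d a q x1 L x : R) : 0 < d -> 0 <= a -> 0 < q ->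
  is_derive (toxin' d a q x1 L) x (toxin'' d a q x1 L x).
Proof.
  intros Hd Ha Hq. destruct (roots_spec d a q Hd Ha Hq) as [_ [_ [_ [Hp2 Hn2]]]].
  unfold toxin''. unfold toxin', toxin.
  set (p := root_pos d a q) in *. set (n := root_neg d a q) in *.
  set (k := toxin_coef d a q x1 L).
  auto_derive; [exact I|].
  unfold Rminus. fold (L - x1) (x - x1).
  set (e1 := exp (n * (L - x1) + p * (x - x1))). set (e2 := exp (p * (L - x1) + n * (x - x1))).
  apply Rmult_eq_reg_r with d; [|lra].
  replace ((a * (k * (p * n) * (e1 + - e2)) + q * (/ q + k * (n * e1 + - (p * e2))) + - (1)) / d * d)
    with (k * (n * e1 * (a * p + q) - p * e2 * (a * n + q))) by (field; lra).
  rewrite <- Hp2, <- Hn2. ring.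
Qed.

Lemma toxin_ode (d a q x1 L x : R) : 0 < d ->
  d * toxin'' d a q x1 L x - a * toxin' d a q x1 L x - q * toxin d a q x1 L x = -1.
Proof. intros Hd. unfold toxin''. field. lra. Qed.

Lemma toxin_left (d a q x1 L : R) : 0 < d -> 0 <= a -> 0 < q -> x1 < L ->
  d * toxin' d a q x1 L x1 - a * toxin d a q x1 L x1 = 0.
Proof.
  intros Hd Ha Hq HxL. pose proof (toxin_coef_denom d a q x1 L Hd Ha Hq HxL) as Hden.
  destruct (roots_spec d a q Hd Ha Hq) as [_ [_ [Hs _]]].
  unfold toxin', toxin, toxin_coef in *.
  set (p := root_pos d a q) in *. set (n := root_neg d a q) in *.
  replace (n * (L - x1) + p * (x1 - x1)) with (n * (L - x1)) by ring.
  replace (p * (L - x1) + n * (x1 - x1)) with (p * (L - x1)) by ring.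
  set (e1 := exp (n * (L - x1))) in *. set (e2 := exp (p * (L - x1))) in *.
  set (den := d * (p ^ 2 * e2 - n ^ 2 * e1)) in *.
  assert (HK : a / q / den * den = a * / q) by (field; lra).
  set (K := a / q / den) in *. clearbody K p n e1 e2.
  replace (d * (K * (p * n) * (e1 - e2)) - a * (/ q + K * (n * e1 - p * e2)))
    with (K * den - a * / q) by (unfold den; rewrite <- Hs; ring).
  lra.
Qed.

Lemma toxin'_right (d a q x1 L : R) : toxin' d a q x1 L L = 0.
Proof.
  unfold toxin'. rewrite (Rplus_comm (root_neg d a q * (L - x1))). ring.
Qed.

Lemma toxin'_nonneg (d a q x1 L x : R) : 0 < d -> 0 <= a -> 0 < q -> x1 < L ->
  x <= L -> 0 <= toxin' d a q x1 L x.
Proof.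
  intros Hd Ha Hq HxL Hx. pose proof (toxin_coef_nonneg d a q x1 L Hd Ha Hq HxL) as Hk.
  destruct (roots_spec d a q Hd Ha Hq) as [Hp [Hn _]]. unfold toxin'.
  set (p := root_pos d a q) in *. set (n := root_neg d a q) in *.
  set (k := toxin_coef d a q x1 L) in *.
  destruct Hx as [Hx| ->].
  - assert (exp (n * (L - x1) + p * (x - x1)) < exp (p * (L - x1) + n * (x - x1))).
    { apply exp_increasing. nra. }
    assert (0 <= k * - (p * n)) by (apply Rmult_le_pos; nra). nra.
  - rewrite (Rplus_comm (n * (L - x1))). right. ring.
Qed.

Lemma toxin'_pos (d a q x1 L x : R) : 0 < d -> 0 < a -> 0 < q -> x1 < L ->
  x < L -> 0 < toxin' d a q x1 L x.
Proof.
  intros Hd Ha Hq HxL Hx. pose proof (toxin_coef_denom d a q x1 L Hd ltac:(lra) Hq HxL) as Hk.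
  destruct (roots_spec d a q Hd ltac:(lra) Hq) as [Hp [Hn _]]. unfold toxin', toxin_coef.
  set (p := root_pos d a q) in *. set (n := root_neg d a q) in *.
  assert (Haq : 0 < a / q) by (apply Rdiv_lt_0_compat; lra).
  pose proof (Rdiv_lt_0_compat _ _ Haq Hk) as Hk'.
  set (k := _ / _ / _) in *.
  assert (exp (n * (L - x1) + p * (x - x1)) < exp (p * (L - x1) + n * (x - x1))).
  { apply exp_increasing. nra. }
  assert (0 < k * - (p * n)) by (apply Rmult_lt_0_compat; nra). nra.
Qed.

Lemma toxin_continuous (d a q x1 L x : R) : continuous (toxin d a q x1 L) x.
Proof.
  apply (ex_derive_continuous (toxin d a q x1 L)). eexists. apply is_derive_toxin.
Qed.

Lemma toxin_pos (d a q x1 L : R) : 0 < d -> 0 <= a -> 0 < q -> x1 < L ->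
  forall x, x1 <= x <= L -> 0 < toxin d a q x1 L x.
Proof.
  intros Hd Ha Hq HxL x Hx.
  apply (max_principle d a q x1 L (toxin d a q x1 L) (toxin' d a q x1 L) (toxin'' d a q x1 L));
    auto.
  - intros; apply is_derive_toxin.
  - intros; apply is_derive_toxin'; assumption.
  - intros t Ht. rewrite toxin_ode by assumption. lra.
  - rewrite toxin_left by assumption. lra.
  - rewrite toxin'_right. lra.
  - rewrite toxin_ode by assumption. lra.
Qed.

(* [s = 1] gives upper and [s = -1] lower bounds for the steady state. *)
Lemma toxin_compare (d a q x1 L s : R) (V V1 V2 : R -> R) :
  0 < d -> 0 <= a -> 0 < q -> x1 < L ->
  (forall x, is_derive V x (V1 x)) -> (forall x, is_derive V1 x (V2 x)) ->
  (forall x, x1 <= x <= L -> d * V2 x - a * V1 x - q * V x <= - s) ->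
  d * V1 x1 - a * V x1 <= 0 -> 0 <= V1 L ->
  forall x, x1 <= x <= L -> s * toxin d a q x1 L x <= V x /\
    (d * V2 x - a * V1 x - q * V x < - s -> s * toxin d a q x1 L x < V x).
Proof.
  intros Hd Ha Hq HxL H1 H2 Hop Hb1 HbL x Hx.
  set (w := toxin d a q x1 L). set (w1 := toxin' d a q x1 L). set (w2 := toxin'' d a q x1 L).
  assert (Hode : forall t, d * (V2 t - s * w2 t) - a * (V1 t - s * w1 t) - q * (V t - s * w t)
                   = d * V2 t - a * V1 t - q * V t + s).
  { intros t. pose proof (toxin_ode d a q x1 L t Hd) as E. fold w w1 w2 in E.
    replace (d * (V2 t - s * w2 t) - a * (V1 t - s * w1 t) - q * (V t - s * w t))
      with (d * V2 t - a * V1 t - q * V t - s * (d * w2 t - a * w1 t - q * w t)) by ring.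
    rewrite E. ring. }
  destruct (max_principle d a q x1 L (fun x => V x - s * w x) (fun x => V1 x - s * w1 x)
    (fun x => V2 x - s * w2 x)) as [Hge Hgt]; auto.
  - intros t. apply (is_derive_minus V (fun x => s * w x)); [apply H1|].
    apply (is_derive_scal w), is_derive_toxin.
  - intros t. apply (is_derive_minus V1 (fun x => s * w1 x)); [apply H2|].
    apply (is_derive_scal w1), is_derive_toxin'; assumption.
  - intros t Ht. rewrite Hode. specialize (Hop t Ht). lra.
  - pose proof (toxin_left d a q x1 L Hd Ha Hq HxL) as E. fold w w1 in E.
    replace (d * (V1 x1 - s * w1 x1) - a * (V x1 - s * w x1))
      with (d * V1 x1 - a * V x1 - s * (d * w1 x1 - a * w x1)) by ring.
    rewrite E. lra.
  - unfold w1. rewrite toxin'_right. lra.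
  - specialize (Hge x Hx). split; [lra|]. intros Hlt.
    specialize (Hgt x Hx ltac:(rewrite Hode; lra)). lra.
Qed.

Lemma is_derive_const_R (k x : R) : is_derive (fun _ : R => k) x 0.
Proof. apply (is_derive_const k). Qed.

Lemma toxin_le_inv (d a q x1 L x : R) : 0 < d -> 0 <= a -> 0 < q -> x1 < L ->
  x1 <= x <= L -> toxin d a q x1 L x <= / q.
Proof.
  intros Hd Ha Hq HxL Hx. rewrite <- (Rmult_1_l (toxin _ _ _ _ _ _)).
  assert (Hi : 0 < / q) by (apply Rinv_0_lt_compat, Hq).
  apply (toxin_compare d a q x1 L 1 (fun _ => / q) (fun _ => 0) (fun _ => 0)); auto.
  - intros; apply is_derive_const_R.
  - intros; apply is_derive_const_R.
  - intros t _. rewrite Rinv_r; lra.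
  - nra.
  - lra.
Qed.

Lemma toxin_no_advection (d q x1 L x : R) : toxin d 0 q x1 L x = / q.
Proof. unfold toxin, toxin_coef, Rdiv. ring. Qed.

Lemma toxin_le_advection (d a q x1 L x : R) : 0 < d -> 0 < a -> 0 < q -> x1 < L ->
  x1 <= x <= L -> toxin d a q x1 L x <= (L - x1 + d / a) / a.
Proof.
  intros Hd Ha Hq HxL Hx. rewrite <- (Rmult_1_l (toxin _ _ _ _ _ _)).
  assert (Hia : 0 < / a) by (apply Rinv_0_lt_compat, Ha).
  assert (Hda : 0 < d / a) by (apply Rdiv_lt_0_compat; lra).
  apply Rle_trans with ((x - x1 + d / a) / a).
  2: { unfold Rdiv at 1 3. apply Rmult_le_compat_r; lra. }
  apply (toxin_compare d a q x1 L 1 (fun x => (x - x1 + d / a) / a) (fun _ => / a) (fun _ => 0));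
    auto; try lra.
  - intros t. auto_derive; [lra|]. field. lra.
  - intros; apply is_derive_const_R.
  - intros t Ht. assert (0 <= (t - x1 + d / a) / a) by (apply Rdiv_le_0_compat; lra).
    rewrite Rinv_r by lra. nra.
  - right. field. lra.
Qed.

Lemma toxin_decr_q (d a q q' x1 L x : R) : 0 < d -> 0 <= a -> 0 < q -> q < q' -> x1 < L ->
  x1 <= x <= L -> toxin d a q' x1 L x < toxin d a q x1 L x.
Proof.
  intros Hd Ha Hq Hqq HxL Hx.
  enough (H : -1 * toxin d a q x1 L x < - toxin d a q' x1 L x) by lra.
  assert (Hpos := toxin_pos d a q' x1 L Hd Ha ltac:(lra) HxL).
  assert (Hode : forall t, d * - toxin'' d a q' x1 L t - a * - toxin' d a q' x1 L t
             - q * - toxin d a q' x1 L t = 1 - (q' - q) * toxin d a q' x1 L t).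
  { intros t. pose proof (toxin_ode d a q' x1 L t Hd). nra. }
  apply (toxin_compare d a q x1 L (-1) (fun x => - toxin d a q' x1 L x)
    (fun x => - toxin' d a q' x1 L x) (fun x => - toxin'' d a q' x1 L x)); auto.
  - intros t. apply (is_derive_opp (toxin d a q' x1 L)), is_derive_toxin.
  - intros t. apply (is_derive_opp (toxin' d a q' x1 L)), is_derive_toxin'; lra.
  - intros t Ht. rewrite Hode. specialize (Hpos t Ht). nra.
  - pose proof (toxin_left d a q' x1 L Hd Ha ltac:(lra) HxL). lra.
  - rewrite toxin'_right. lra.
  - rewrite Hode. specialize (Hpos x Hx). nra.
Qed.

Lemma toxin_decr_a (d a a' q x1 L x : R) : 0 < d -> 0 <= a -> a < a' -> 0 < q -> x1 < L ->
  x1 <= x < L -> toxin d a' q x1 L x < toxin d a q x1 L x.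
Proof.
  intros Hd Ha Haa Hq HxL Hx.
  enough (H : -1 * toxin d a q x1 L x < - toxin d a' q x1 L x) by lra.
  assert (Hode : forall t, d * - toxin'' d a' q x1 L t - a * - toxin' d a' q x1 L t
             - q * - toxin d a' q x1 L t = 1 - (a' - a) * toxin' d a' q x1 L t).
  { intros t. pose proof (toxin_ode d a' q x1 L t Hd). nra. }
  apply (toxin_compare d a q x1 L (-1) (fun x => - toxin d a' q x1 L x)
    (fun x => - toxin' d a' q x1 L x) (fun x => - toxin'' d a' q x1 L x)); auto; try lra.
  - intros t. apply (is_derive_opp (toxin d a' q x1 L)), is_derive_toxin.
  - intros t. apply (is_derive_opp (toxin' d a' q x1 L)), is_derive_toxin'; lra.
  - intros t Ht. rewrite Hode.
    pose proof (toxin'_nonneg d a' q x1 L t Hd ltac:(lra) Hq HxL ltac:(lra)). nra.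
  - pose proof (toxin_left d a' q x1 L Hd ltac:(lra) Hq HxL).
    pose proof (toxin_pos d a' q x1 L Hd ltac:(lra) Hq HxL x1 ltac:(lra)). nra.
  - rewrite toxin'_right. lra.
  - rewrite Hode. pose proof (toxin'_pos d a' q x1 L x Hd ltac:(lra) Hq HxL ltac:(lra)). nra.
Qed.

Lemma Rmult_le_bounds (x t w B : R) : x <= t -> 0 <= t -> 0 <= w <= B -> x * w <= t * B.
Proof.
  intros Hx Ht Hw. apply Rle_trans with (t * w).
  - apply Rmult_le_compat_r; lra.
  - apply Rmult_le_compat_l; lra.
Qed.

Lemma toxin_cont_a (d a0 q x1 L : R) : 0 < d -> 0 <= a0 -> 0 < q -> x1 < L ->
  exists C, 0 <= C /\ forall a, 0 <= a <= a0 + 1 -> forall x, x1 <= x <= L ->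
    Rabs (toxin d a q x1 L x - toxin d a0 q x1 L x) <= C * Rabs (a - a0).
Proof.
  intros Hd Ha0 Hq HxL.
  set (w := toxin d a0 q x1 L). set (w1 := toxin' d a0 q x1 L). set (w2 := toxin'' d a0 q x1 L).
  destruct (continuity_ab_maj w1 x1 L ltac:(lra)) as [tm [Hmax Htm]].
  { intros x _. apply continuity_pt_filterlim, (ex_derive_continuous w1).
    eexists. apply is_derive_toxin'; assumption. }
  assert (Hw1 : forall x, x1 <= x <= L -> 0 <= w1 x).
  { intros x Hx. apply toxin'_nonneg; lra. }
  assert (Hiq : 0 < / q) by (apply Rinv_0_lt_compat, Hq).
  set (B := w1 tm + / q).
  assert (HB0 : 0 < B) by (unfold B; specialize (Hw1 tm Htm); lra).
  assert (HB1 : forall x, x1 <= x <= L -> w1 x <= B).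
  { intros x Hx. unfold B. specialize (Hmax x Hx). lra. }
  assert (HB2 : 0 <= w x1 <= B).
  { split; [left; apply toxin_pos; lra|]. apply Rle_trans with (/ q).
    - apply toxin_le_inv; lra.
    - unfold B. specialize (Hw1 tm Htm). lra. }
  set (l := L - x1). assert (Hl : 0 < l) by (unfold l; lra).
  assert (Hil : 0 < / l) by (apply Rinv_0_lt_compat, Hl).
  assert (Had : 0 < (a0 + 1) / d) by (apply Rdiv_lt_0_compat; lra).
  set (A := (1 + / l + (a0 + 1) / d) / q).
  assert (HA : q * A = 1 + / l + (a0 + 1) / d) by (unfold A; field; lra).
  assert (HA0 : 0 < A) by (apply Rdiv_lt_0_compat; lra).
  set (beta := fun x => A + (L - x) ^ 2 / (2 * l * d)).
  set (beta1 := fun x => - ((L - x) / (l * d))).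
  set (beta2 := fun _ : R => / (l * d)).
  assert (Hld : 0 < l * d) by (apply Rmult_lt_0_compat; assumption).
  assert (Hbeta : forall x, x1 <= x <= L -> A <= beta x <= A + l ^ 2 / (2 * l * d)).
  { intros x Hx. unfold beta.
    assert (0 <= (L - x) ^ 2 / (2 * l * d)) by (apply Rdiv_le_0_compat; [apply pow2_ge_0|lra]).
    assert ((L - x) ^ 2 / (2 * l * d) <= l ^ 2 / (2 * l * d)).
    { apply Rmult_le_compat_r; [left; apply Rinv_0_lt_compat; lra|]. unfold l. nra. }
    lra. }
  set (bmax := A + l ^ 2 / (2 * l * d)).
  assert (Hbm : 0 <= bmax) by (specialize (Hbeta L ltac:(lra)); unfold bmax; lra).
  exists (B * bmax). split; [nra|]. intros a Ha x Hx.
  set (t := Rabs (a - a0)). set (eta := t * B).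
  assert (Ht : 0 <= t) by apply Rabs_pos.
  assert (Heta : 0 <= eta) by (apply Rmult_le_pos; lra).
  assert (Hop : forall y, x1 <= y <= L -> d * beta2 y - a * beta1 y - q * beta y <= -1).
  { intros y Hy. destruct (Hbeta y Hy) as [Hby _].
    assert (H1 : d * beta2 y = / l) by (unfold beta2; field; lra).
    assert (H2 : - (a * beta1 y) <= (a0 + 1) / d).
    { replace (- (a * beta1 y)) with (a * ((L - y) / l) / d) by (unfold beta1; field; lra).
      apply Rmult_le_compat_r; [left; apply Rinv_0_lt_compat, Hd|].
      assert (0 <= (L - y) / l <= 1).
      { split; [apply Rdiv_le_0_compat; lra|].
        apply Rmult_le_reg_r with l; [exact Hl|]. unfold Rdiv.
        rewrite Rmult_assoc, Rinv_l by lra. unfold l. lra. }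
      nra. }
    nra. }
  assert (Hside : forall s, s = 1 \/ s = -1 -> s * toxin d a q x1 L x <= s * w x + eta * beta x).
  { intros s Hs.
    assert (Hst : s * (a0 - a) <= t).
    { unfold t. destruct Hs as [-> | ->]; unfold Rabs; destruct (Rcase_abs _); lra. }
    apply (toxin_compare d a q x1 L s (fun x => s * w x + eta * beta x)
      (fun x => s * w1 x + eta * beta1 x) (fun x => s * w2 x + eta * beta2 x)); auto; try lra.
    - intros y. apply (is_derive_plus (fun x => s * w x) (fun x => eta * beta x)).
      + apply (is_derive_scal w), is_derive_toxin.
      + apply (is_derive_scal beta). unfold beta, beta1. auto_derive; [lra|]. field. lra.
    - intros y. apply (is_derive_plus (fun x => s * w1 x) (fun x => eta * beta1 x)).
      + apply (is_derive_scal w1), is_derive_toxin'; assumption.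
      + apply (is_derive_scal beta1). unfold beta1, beta2. auto_derive; [lra|]. field. lra.
    - intros y Hy. pose proof (toxin_ode d a0 q x1 L y Hd) as E. fold w w1 w2 in E.
      replace (d * (s * w2 y + eta * beta2 y) - a * (s * w1 y + eta * beta1 y)
               - q * (s * w y + eta * beta y))
        with (s * (d * w2 y - a0 * w1 y - q * w y) + s * (a0 - a) * w1 y
              + eta * (d * beta2 y - a * beta1 y - q * beta y)) by ring.
      rewrite E. specialize (Hop y Hy). specialize (Hw1 y Hy). specialize (HB1 y Hy).
      assert (s * (a0 - a) * w1 y <= t * B) by (apply Rmult_le_bounds; lra).
      assert (eta * (d * beta2 y - a * beta1 y - q * beta y) <= - eta) by nra.
      unfold eta in *. lra.
    - pose proof (toxin_left d a0 q x1 L Hd Ha0 Hq HxL) as E. fold w w1 in E.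
      replace (d * (s * w1 x1 + eta * beta1 x1) - a * (s * w x1 + eta * beta x1))
        with (s * (d * w1 x1 - a0 * w x1) + s * (a0 - a) * w x1
              + eta * (d * beta1 x1 - a * beta x1)) by ring.
      rewrite E.
      assert (Hd1 : d * beta1 x1 = -1) by (unfold beta1, l; field; lra).
      destruct (Hbeta x1 ltac:(lra)) as [Hb1 _].
      assert (s * (a0 - a) * w x1 <= t * B) by (apply Rmult_le_bounds; lra).
      assert (0 <= a * beta x1) by (apply Rmult_le_pos; lra).
      assert (eta * (d * beta1 x1 - a * beta x1) <= - eta) by (rewrite Hd1; nra).
      unfold eta in *. lra.
    - unfold w1. rewrite toxin'_right. unfold beta1.
      replace (L - L) with 0 by ring. unfold Rdiv. rewrite Rmult_0_l. lra. }
  destruct (Hbeta x Hx) as [_ Hbx]. fold bmax in Hbx.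
  pose proof (Hside 1 (or_introl eq_refl)). pose proof (Hside (-1) (or_intror eq_refl)).
  assert (Hle : eta * beta x <= eta * bmax) by (apply Rmult_le_compat_l; lra).
  replace (eta * bmax) with (B * bmax * t) in Hle by (unfold eta; ring).
  fold w. apply Rabs_le. lra.
Qed.

Lemma toxin_cont_q (d a q0 x1 L : R) : 0 < d -> 0 <= a -> 0 < q0 -> x1 < L ->
  exists C, 0 <= C /\ forall q, q0 / 2 <= q -> forall x, x1 <= x <= L ->
    Rabs (toxin d a q x1 L x - toxin d a q0 x1 L x) <= C * Rabs (q - q0).
Proof.
  intros Hd Ha Hq0 HxL.
  set (w := toxin d a q0 x1 L). set (w1 := toxin' d a q0 x1 L). set (w2 := toxin'' d a q0 x1 L).
  assert (Hiq : 0 < / q0) by (apply Rinv_0_lt_compat, Hq0).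
  assert (Hw : forall x, x1 <= x <= L -> 0 <= w x <= / q0).
  { intros x Hx. split; [left; apply toxin_pos; lra|apply toxin_le_inv; lra]. }
  exists (2 / q0 * / q0). split; [apply Rmult_le_pos; [apply Rdiv_le_0_compat|]; lra|].
  intros q Hq x Hx. set (t := Rabs (q - q0)). set (eta := 2 / q0 * / q0 * t).
  assert (Ht : 0 <= t) by apply Rabs_pos.
  assert (Heta : t * / q0 <= q * eta).
  { replace (t * / q0) with (q0 / 2 * eta) by (unfold eta; field; lra).
    apply Rmult_le_compat_r; [|exact Hq]. apply Rmult_le_pos; [|exact Ht].
    apply Rmult_le_pos; [apply Rdiv_le_0_compat|]; lra. }
  assert (Heta0 : 0 <= eta).
  { apply Rmult_le_pos; [|exact Ht]. apply Rmult_le_pos; [apply Rdiv_le_0_compat|]; lra. }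
  assert (Hside : forall s, s = 1 \/ s = -1 -> s * toxin d a q x1 L x <= s * w x + eta).
  { intros s Hs.
    assert (Hst : s * (q0 - q) <= t).
    { unfold t. destruct Hs as [-> | ->]; unfold Rabs; destruct (Rcase_abs _); lra. }
    apply (toxin_compare d a q x1 L s (fun x => s * w x + eta)
      (fun x => s * w1 x) (fun x => s * w2 x)); auto; try lra.
    - intros y. replace (s * w1 y) with (s * w1 y + 0) by ring.
      apply (is_derive_plus (fun x => s * w x) (fun x => eta)).
      + apply (is_derive_scal w), is_derive_toxin.
      + apply is_derive_const_R.
    - intros y. apply (is_derive_scal w1), is_derive_toxin'; assumption.
    - intros y Hy. pose proof (toxin_ode d a q0 x1 L y Hd) as E. fold w w1 w2 in E.
      replace (d * (s * w2 y) - a * (s * w1 y) - q * (s * w y + eta))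
        with (s * (d * w2 y - a * w1 y - q0 * w y) + s * (q0 - q) * w y - q * eta) by ring.
      rewrite E. specialize (Hw y Hy).
      assert (s * (q0 - q) * w y <= t * / q0) by (apply Rmult_le_bounds; lra). lra.
    - pose proof (toxin_left d a q0 x1 L Hd Ha Hq0 HxL) as E. fold w w1 in E.
      replace (d * (s * w1 x1) - a * (s * w x1 + eta))
        with (s * (d * w1 x1 - a * w x1) - a * eta) by ring.
      rewrite E. nra.
    - unfold w1. rewrite toxin'_right. lra. }
  pose proof (Hside 1 (or_introl eq_refl)). pose proof (Hside (-1) (or_intror eq_refl)).
  fold w eta. apply Rabs_le. lra.
Qed.

(** * The stability threshold *)

Lemma is_lambda1_of_riccati_eig (d a r m x1 L lam : R) (w : R -> R) :
  0 < d -> 0 <= x1 < L -> (forall x, continuous w x) ->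
  riccati_eig (a / d) d r x1 L lam (fun x => m * w x) ->
  is_lambda1 d a (pot r m x1 L w) 0 L lam.
Proof.
  intros Hd Hx1 Hw [y [Cy [Y0 [YL [YP YQ]]]]].
  set (phi := fun x => exp (RInt y 0 x)).
  assert (Hphi : forall x, is_derive phi x (y x * phi x)).
  { intros x. apply (is_derive_comp exp (fun x => RInt y 0 x)).
    - apply is_derive_exp.
    - apply is_derive_primitive, Cy. }
  assert (Hpc : forall x, continuous phi x).
  { intros x. apply (ex_derive_continuous phi). eexists. apply Hphi. }
  set (psi := fun x => (d * y x - a) * phi x).
  assert (Hpsic : forall x, continuous psi x).
  { intros x. apply (continuous_mult (fun x => d * y x - a) phi); [|apply Hpc].
    apply (continuous_minus (fun x => d * y x) (fun _ => a)); [|apply continuous_const].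
    apply continuous_scal_fun, Cy. }
  assert (Hpsid : forall x s, is_derive y x (- y x ^ 2 + a / d * y x + s / d) ->
            is_derive psi x (s * phi x)).
  { intros x s Hy.
    replace (s * phi x) with
      ((d * (- y x ^ 2 + a / d * y x + s / d) - 0 + (d * y x - a) * y x) * phi x)
      by (field; lra).
    apply (is_derive_mult_exp (fun x => d * y x - a) (fun x => RInt y 0 x)).
    - apply (is_derive_minus (fun x => d * y x) (fun _ => a)).
      + apply (is_derive_scal y), Hy.
      + apply is_derive_const_R.
    - apply is_derive_primitive, Cy. }
  assert (Hpsi0 : psi 0 = 0).
  { unfold psi. rewrite Y0. replace (d * (a / d) - a) with 0 by (field; lra). ring. }
  set (f := fun t => (lam - pot r m x1 L w t) * phi t).
  assert (Hleft : forall x, 0 <= x <= x1 -> is_RInt f 0 x (psi x)).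
  { intros x Hx. apply (is_RInt_ext (fun t => (lam - r) * phi t)).
    - rewrite Rmin_left, Rmax_right by lra. intros t Ht. unfold f, pot, chi.
      destruct (Rlt_dec x1 t); [lra|]. f_equal. ring.
    - replace (psi x) with (psi x - psi 0) by lra.
      apply is_RInt_open_derive; auto; [lra|apply continuous_scal_fun, Hpc|].
      intros t Ht. apply Hpsid, YP. lra. }
  assert (Hright : forall x, x1 <= x <= L -> is_RInt f x1 x (psi x - psi x1)).
  { intros x Hx. apply (is_RInt_ext (fun t => (lam - r + m * w t) * phi t)).
    - rewrite Rmin_left, Rmax_right by lra. intros t Ht. unfold f, pot, chi.
      destruct (Rlt_dec x1 t); [|lra]. destruct (Rle_dec t L); [|lra]. f_equal. ring.
    - apply is_RInt_open_derive; auto; [lra| |].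
      + intros t. apply (continuous_mult (fun t => lam - r + m * w t) phi); [|apply Hpc].
        apply (continuous_plus (fun _ => lam - r) (fun t => m * w t)); [apply continuous_const|].
        apply continuous_scal_fun, Hw.
      + intros t Ht. apply Hpsid, YQ. lra. }
  assert (Hall : forall x, 0 <= x <= L -> is_RInt f 0 x (psi x)).
  { intros x Hx. destruct (Rle_dec x x1); [apply Hleft; lra|].
    replace (psi x) with (plus (psi x1) (psi x - psi x1)) by (unfold plus; simpl; ring).
    apply (is_RInt_Chasles f 0 x1 x); [apply Hleft|apply Hright]; lra. }
  exists phi. split; [intros; apply exp_pos|]. split.
  { intros x _. eexists. apply Hphi. }
  split.
  - intros x Hx. split; [exists (psi x); apply Hall, Hx|].
    rewrite (is_derive_unique _ _ _ (Hphi x)).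
    transitivity (psi x); [unfold psi; ring|]. symmetry.
    apply (is_RInt_unique (V := R_CompleteNormedModule)), Hall, Hx.
  - rewrite (is_derive_unique _ _ _ (Hphi L)), YL. ring.
Qed.

Lemma wtilde_sol_toxin (d a h q x1 L : R) : 0 < d -> 0 <= a -> 0 < q -> 0 < h -> x1 < L ->
  wtilde_sol d a h q x1 L (fun x => h * toxin d a q x1 L x).
Proof.
  intros Hd Ha Hq Hh HxL.
  set (w := toxin d a q x1 L). set (w1 := toxin' d a q x1 L). set (w2 := toxin'' d a q x1 L).
  assert (H1 : forall x, is_derive (fun x => h * w x) x (h * w1 x)).
  { intros x. apply (is_derive_scal w), is_derive_toxin. }
  assert (E1 : forall x, Derive (fun x => h * w x) x = h * w1 x).
  { intros x. apply is_derive_unique, H1. }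
  assert (H2 : forall x, is_derive (Derive (fun x => h * w x)) x (h * w2 x)).
  { intros x. apply (is_derive_ext (fun x => h * w1 x)); [intros; symmetry; apply E1|].
    apply (is_derive_scal w1), is_derive_toxin'; assumption. }
  assert (E2 : forall x, Derive (Derive (fun x => h * w x)) x = h * w2 x).
  { intros x. apply is_derive_unique, H2. }
  split; [intros x _; split; eexists; [apply H1|apply H2]|].
  split; [|split; [|split]].
  - intros x _. rewrite E2, E1. pose proof (toxin_ode d a q x1 L x Hd) as E. fold w w1 w2 in E.
    replace (d * (h * w2 x) - a * (h * w1 x) + h - q * (h * w x))
      with (h * (d * w2 x - a * w1 x - q * w x + 1)) by ring.
    rewrite E. ring.
  - rewrite E1. pose proof (toxin_left d a q x1 L Hd Ha Hq HxL) as E. fold w w1 in E.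
    replace (d * (h * w1 x1) - a * (h * w x1)) with (h * (d * w1 x1 - a * w x1)) by ring.
    rewrite E. ring.
  - rewrite E1. unfold w1. rewrite toxin'_right. ring.
  - intros x Hx. apply Rmult_lt_0_compat; [exact Hh|]. apply toxin_pos; assumption.
Qed.

Definition is_threshold (b d r x1 L : R) (c : R -> R) (Ms : R) : Prop :=
  0 < Ms /\ forall M, 0 < M -> exists lam, riccati_eig b d r x1 L lam (fun x => M * c x) /\
    (M < Ms -> 0 < lam) /\ (Ms < M -> lam < 0) /\ (M = Ms -> lam = 0).

Lemma threshold_lt (b d r x1 L Ms M lam : R) (c : R -> R) :
  0 < d -> 0 <= x1 < L -> is_threshold b d r x1 L c Ms -> 0 < M ->
  riccati_eig b d r x1 L lam (fun x => M * c x) ->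
  (M < Ms <-> 0 < lam) /\ (Ms < M <-> lam < 0).
Proof.
  intros Hd Hx1 [HMs HT] HM Hlam.
  destruct (HT M HM) as [l [Hl [H1 [H2 H3]]]].
  assert (E : l = lam).
  { pose proof (riccati_eig_perturb b d r x1 L l lam 0 _ _ Hd Hx1 Hl Hlam
      (Rle_refl 0) ltac:(intros; lra)).
    pose proof (riccati_eig_perturb b d r x1 L lam l 0 _ _ Hd Hx1 Hlam Hl
      (Rle_refl 0) ltac:(intros; lra)). lra. }
  subst l. destruct (Rtotal_order M Ms) as [H|[H|H]].
  - specialize (H1 H). repeat split; lra.
  - specialize (H3 H). repeat split; lra.
  - specialize (H2 H). repeat split; lra.
Qed.

Lemma threshold_decr (b d r x1 L Ms Ms' : R) (c c' : R -> R) :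
  0 < d -> 0 <= x1 < L -> is_threshold b d r x1 L c Ms -> is_threshold b d r x1 L c' Ms' ->
  (forall x, x1 < x < L -> c' x < c x) -> Ms < Ms'.
Proof.
  intros Hd Hx1 HT HT' Hlt. pose proof (proj1 HT) as HMs.
  destruct (proj2 HT Ms HMs) as [l [Hl [_ [_ H0]]]]. specialize (H0 eq_refl). subst l.
  destruct (proj2 HT' Ms HMs) as [l' [Hl' _]].
  apply (threshold_lt b d r x1 L Ms' Ms l' c' Hd Hx1 HT' HMs Hl').
  apply (riccati_eig_decr b d r x1 L l' 0 _ _ Hd Hx1 Hl' Hl).
  intros x Hx. apply Rmult_lt_compat_l; auto.
Qed.

Lemma threshold_continuous (b d r x1 L Ms e : R) (c : R -> R) :
  0 < d -> 0 <= x1 < L -> is_threshold b d r x1 L c Ms -> 0 < e ->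
  exists eta, 0 < eta /\ forall c' Ms', is_threshold b d r x1 L c' Ms' ->
    (forall x, x1 < x < L -> Rabs (c' x - c x) <= eta) -> Rabs (Ms' - Ms) < e.
Proof.
  intros Hd Hx1 HT He. pose proof (proj1 HT) as HMs.
  set (M2 := Ms + e / 2). set (M1 := Rmax (Ms / 2) (Ms - e / 2)).
  assert (HM1 : Ms / 2 <= M1 /\ Ms - e / 2 <= M1 /\ M1 < Ms).
  { split; [apply Rmax_l|]. split; [apply Rmax_r|]. apply Rmax_lub_lt; lra. }
  assert (HM2 : Ms < M2) by (unfold M2; lra).
  destruct (proj2 HT M1 ltac:(lra)) as [l1 [Hl1 [P1 _]]]. specialize (P1 (proj2 (proj2 HM1))).
  destruct (proj2 HT M2 ltac:(lra)) as [l2 [Hl2 [_ [P2 _]]]]. specialize (P2 HM2).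
  set (eta := Rmin (l1 / (2 * M1)) (- l2 / (2 * M2))).
  assert (Heta : 0 < eta).
  { apply Rmin_glb_lt; apply Rdiv_lt_0_compat; lra. }
  assert (He1 : M1 * eta <= l1 / 2).
  { apply Rle_trans with (M1 * (l1 / (2 * M1))); [|right; field; lra].
    apply Rmult_le_compat_l; [lra|apply Rmin_l]. }
  assert (He2 : M2 * eta <= - l2 / 2).
  { apply Rle_trans with (M2 * (- l2 / (2 * M2))); [|right; field; lra].
    apply Rmult_le_compat_l; [lra|apply Rmin_r]. }
  exists eta. split; [exact Heta|]. intros c' Ms' HT' Hclose.
  assert (H1 : M1 < Ms').
  { destruct (proj2 HT' M1 ltac:(lra)) as [l [Hl _]].
    apply (threshold_lt b d r x1 L Ms' M1 l c' Hd Hx1 HT' ltac:(lra) Hl).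
    assert (l1 - M1 * eta <= l); [|lra].
    apply (riccati_eig_perturb b d r x1 L l1 l _ _ _ Hd Hx1 Hl1 Hl); [nra|].
    intros x Hx. specialize (Hclose x Hx). apply Rabs_le_between in Hclose. nra. }
  assert (H2 : Ms' < M2).
  { destruct (proj2 HT' M2 ltac:(lra)) as [l [Hl _]].
    apply (threshold_lt b d r x1 L Ms' M2 l c' Hd Hx1 HT' ltac:(lra) Hl).
    assert (l - M2 * eta <= l2); [|lra].
    apply (riccati_eig_perturb b d r x1 L l l2 _ _ _ Hd Hx1 Hl Hl2); [nra|].
    intros x Hx. specialize (Hclose x Hx). apply Rabs_le_between in Hclose. nra. }
  unfold M2 in H2. apply Rabs_def1; lra.
Qed.

Lemma unstable_of_threshold (d1 d2 r m q h a1 a2 x1 L Ms : R) :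
  0 < d1 -> 0 < d2 -> 0 <= a2 -> 0 < q -> 0 < h -> 0 < m -> 0 <= x1 < L ->
  is_threshold (a1 / d1) d1 r x1 L (toxin d2 a2 q x1 L) Ms ->
  (m * h < Ms -> unstable d1 d2 r m q h a1 a2 x1 L) /\
  (Ms < m * h -> lin_stable d1 d2 r m q h a1 a2 x1 L).
Proof.
  intros Hd1 Hd2 Ha2 Hq Hh Hm Hx1 [_ HT].
  destruct (HT (m * h) ltac:(apply Rmult_lt_0_compat; assumption))
    as [lam [Hlam [H1 [H2 _]]]].
  assert (Hsol := wtilde_sol_toxin d2 a2 h q x1 L Hd2 Ha2 Hq Hh (proj2 Hx1)).
  assert (Heig : is_lambda1 d1 a1 (pot r m x1 L (fun x => h * toxin d2 a2 q x1 L x)) 0 L lam).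
  { apply is_lambda1_of_riccati_eig; auto.
    - apply continuous_scal_fun. intros; apply toxin_continuous.
    - destruct Hlam as [y [Cy [Y0 [YL [YP YQ]]]]].
      exists y. repeat (split; [assumption|]). intros x Hx.
      rewrite <- Rmult_assoc. apply YQ, Hx. }
  split; intros H; eexists; (split; [exact Hsol|]); exists lam; split; auto.
Qed.

Lemma IVT_half_line (f : R -> R) (lo hi y : R) :
  lo <= hi ->
  (forall x, lo <= x -> forall e, 0 < e -> exists de, 0 < de /\
     forall t, lo <= t -> Rabs (t - x) < de -> Rabs (f t - f x) < e) ->
  f lo <= y <= f hi -> exists x, lo <= x <= hi /\ f x = y.
Proof.
  intros Hlh Hf Hy.
  destruct (IVT_gen (fun x => f (Rmax lo x)) lo hi y) as [x [Hx Hfx]].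
  - intros x e He. destruct (Hf (Rmax lo x) (Rmax_l _ _) e He) as [de [Hde H]].
    exists de. split; [exact Hde|]. intros t [_ Ht]. simpl in *. unfold R_dist in *.
    apply H; [apply Rmax_l|]. apply Rle_lt_trans with (2 := Ht). apply Rmax_lipschitz.
  - rewrite (Rmax_left lo lo), (Rmax_right lo hi) by lra. rewrite Rmin_left, Rmax_right; lra.
  - rewrite (Rmin_left lo hi), (Rmax_right lo hi) in Hx by lra.
    exists x. split; [exact Hx|]. rewrite Rmax_right in Hfx by lra. exact Hfx.
Qed.

(* [F a2 q] is the value of the product [m * h] at which stability changes. *)
Lemma stability_threshold (d1 d2 r L a1 x1 : R) :
  0 < d1 -> 0 < d2 -> 0 < r -> 0 <= x1 < L -> 0 < a1 -> a1 < sqrt (4 * d1 * r) ->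
  L1star d1 r a1 < L -> x1 < Lstar d1 r a1 ->
  exists F : R -> R -> R,
    (forall a2 q, 0 <= a2 -> 0 < q -> 0 < F a2 q) /\
    (forall a2 q m h, 0 <= a2 -> 0 < q -> 0 < m -> 0 < h ->
       (m * h < F a2 q -> unstable d1 d2 r m q h a1 a2 x1 L) /\
       (F a2 q < m * h -> lin_stable d1 d2 r m q h a1 a2 x1 L)) /\
    (forall a a' q, 0 <= a -> a < a' -> 0 < q -> F a q < F a' q) /\
    (forall a q q', 0 <= a -> 0 < q -> q < q' -> F a q < F a q') /\
    (forall q, 0 < q -> forall a, 0 <= a -> forall e, 0 < e -> exists de, 0 < de /\
       forall t, 0 <= t -> Rabs (t - a) < de -> Rabs (F t q - F a q) < e) /\
    (forall a, 0 <= a -> forall q, 0 < q -> forall e, 0 < e -> exists de, 0 < de /\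
       forall t, 0 < t -> Rabs (t - q) < de -> Rabs (F a t - F a q) < e) /\
    (forall M, 0 < M -> exists A, 0 < A /\ forall q, 0 < q -> M < F A q) /\
    (forall M, 0 < M -> exists Q, 0 < Q /\ forall a q, 0 <= a -> Q <= q -> M < F a q) /\
    (forall M, 0 < M -> exists q, 0 < q /\ F 0 q < M).
Proof.
  intros Hd1 Hd2 Hr Hx1 Ha1 Had HL1 HLs.
  destruct (riccati_eig_pos_of_small d1 r a1 x1 L Hd1 Hr Ha1 Had Hx1 HL1) as [eps [Heps Hsmall]].
  destruct (riccati_eig_neg_of_large d1 r a1 x1 L Hd1 Hr Ha1 Had Hx1 HLs) as [K [HK Hlarge]].
  set (thr := fun a q => is_threshold (a1 / d1) d1 r x1 L (toxin d2 a q x1 L)).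
  set (F := fun a q => epsilon (inhabits 0) (thr a q)).
  assert (Hb : 0 < a1 / d1) by (apply Rdiv_lt_0_compat; assumption).
  assert (HF : forall a q, 0 <= a -> 0 < q -> thr a q (F a q)).
  { intros a q Ha Hq. apply epsilon_spec.
    apply (critical_amplitude (a1 / d1) d1 r x1 L eps K); auto.
    - intros; apply toxin_continuous.
    - intros x Hx. apply toxin_pos; lra. }
  assert (Hgt : forall a q M, 0 <= a -> 0 < q -> 0 < M ->
            (forall x, x1 < x < L -> M * toxin d2 a q x1 L x <= eps) -> M < F a q).
  { intros a q M Ha Hq HM Hle. destruct (proj2 (HF a q Ha Hq) M HM) as [l [Hl _]].
    apply (threshold_lt (a1 / d1) d1 r x1 L (F a q) M l (toxin d2 a q x1 L)); auto.
    - apply HF; assumption.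
    - apply (Hsmall _ l Hle Hl). }
  exists F. split; [|split; [|split; [|split; [|split; [|split; [|split; [|split]]]]]]].
  - intros a q Ha Hq. apply (HF a q Ha Hq).
  - intros a q m h Ha Hq Hm Hh. apply unstable_of_threshold; auto. apply HF; assumption.
  - intros a a' q Ha Haa Hq.
    apply (threshold_decr (a1 / d1) d1 r x1 L _ _ _ _ Hd1 Hx1 (HF a q Ha Hq)
             (HF a' q ltac:(lra) Hq)).
    intros x Hx. apply toxin_decr_a; lra.
  - intros a q q' Ha Hq Hqq.
    apply (threshold_decr (a1 / d1) d1 r x1 L _ _ _ _ Hd1 Hx1 (HF a q Ha Hq)
             (HF a q' Ha ltac:(lra))).
    intros x Hx. apply toxin_decr_q; lra.
  - intros q Hq a Ha e He.
    destruct (threshold_continuous (a1 / d1) d1 r x1 L _ e _ Hd1 Hx1 (HF a q Ha Hq) He)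
      as [eta [Heta Hc]].
    destruct (toxin_cont_a d2 a q x1 L Hd2 Ha Hq (proj2 Hx1)) as [C [HC HCw]].
    assert (Hq1 : 0 < eta / (C + 1)) by (apply Rdiv_lt_0_compat; lra).
    exists (Rmin 1 (eta / (C + 1))). split; [apply Rmin_glb_lt; lra|].
    intros t Ht Hta.
    assert (Ht1 : Rabs (t - a) < 1) by (apply Rlt_le_trans with (1 := Hta), Rmin_l).
    assert (Ht2 : Rabs (t - a) < eta / (C + 1)) by (apply Rlt_le_trans with (1 := Hta), Rmin_r).
    apply (Hc (toxin d2 t q x1 L)); [apply HF; assumption|].
    intros x Hx. apply Rabs_def2 in Ht1.
    apply Rle_trans with (1 := HCw t ltac:(lra) x ltac:(lra)).
    apply Rle_trans with ((C + 1) * (eta / (C + 1))); [|right; field; lra].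
    pose proof (Rabs_pos (t - a)). apply Rmult_le_compat; lra.
  - intros a Ha q Hq e He.
    destruct (threshold_continuous (a1 / d1) d1 r x1 L _ e _ Hd1 Hx1 (HF a q Ha Hq) He)
      as [eta [Heta Hc]].
    destruct (toxin_cont_q d2 a q x1 L Hd2 Ha Hq (proj2 Hx1)) as [C [HC HCw]].
    assert (Hq1 : 0 < eta / (C + 1)) by (apply Rdiv_lt_0_compat; lra).
    exists (Rmin (q / 2) (eta / (C + 1))). split; [apply Rmin_glb_lt; lra|].
    intros t Ht Hta.
    assert (Ht1 : Rabs (t - q) < q / 2) by (apply Rlt_le_trans with (1 := Hta), Rmin_l).
    assert (Ht2 : Rabs (t - q) < eta / (C + 1)) by (apply Rlt_le_trans with (1 := Hta), Rmin_r).
    apply (Hc (toxin d2 a t x1 L)); [apply HF; assumption|].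
    intros x Hx. apply Rabs_def2 in Ht1.
    apply Rle_trans with (1 := HCw t ltac:(lra) x ltac:(lra)).
    apply Rle_trans with ((C + 1) * (eta / (C + 1))); [|right; field; lra].
    pose proof (Rabs_pos (t - q)). apply Rmult_le_compat; lra.
  - intros M HM. set (A := 1 + M * (L - x1 + d2) / eps).
    assert (HA : 1 < A).
    { assert (0 < M * (L - x1 + d2) / eps); [|unfold A; lra].
      apply Rdiv_lt_0_compat; [apply Rmult_lt_0_compat; lra|exact Heps]. }
    exists A. split; [lra|]. intros q Hq. apply Hgt; try lra. intros x Hx.
    apply Rle_trans with (M * ((L - x1 + d2) / A)).
    + apply Rmult_le_compat_l; [lra|].
      apply Rle_trans with (1 := toxin_le_advection d2 A q x1 L x Hd2 ltac:(lra) Hq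
        ltac:(lra) ltac:(lra)).
      apply Rmult_le_compat_r; [left; apply Rinv_0_lt_compat; lra|].
      apply Rplus_le_compat_l. apply Rmult_le_reg_r with A; [lra|].
      unfold Rdiv. rewrite Rmult_assoc, Rinv_l by lra. nra.
    + apply Rmult_le_reg_r with A; [lra|].
      replace (M * ((L - x1 + d2) / A) * A) with (M * (L - x1 + d2)) by (field; lra).
      replace (eps * A) with (eps + M * (L - x1 + d2)) by (unfold A; field; lra). lra.
  - intros M HM. assert (HMe : 0 < M / eps) by (apply Rdiv_lt_0_compat; assumption).
    exists (M / eps). split; [exact HMe|]. intros a q Ha Hq. apply Hgt; try lra.
    intros x Hx. apply Rle_trans with (M * / (M / eps)); [|right; field; lra].
    apply Rmult_le_compat_l; [lra|].
    apply Rle_trans with (1 := toxin_le_inv d2 a q x1 L x Hd2 Ha ltac:(lra) ltac:(lra)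
      ltac:(lra)).
    apply Rinv_le_contravar; assumption.
  - intros M HM. assert (HMK : 0 < M / K) by (apply Rdiv_lt_0_compat; assumption).
    exists (M / K). split; [exact HMK|].
    destruct (proj2 (HF 0 (M / K) (Rle_refl 0) HMK) M HM) as [l [Hl _]].
    apply (threshold_lt (a1 / d1) d1 r x1 L (F 0 (M / K)) M l (toxin d2 0 (M / K) x1 L)); auto.
    + apply HF; [lra|assumption].
    + apply (Hlarge _ l) with (2 := Hl). intros x Hx. rewrite toxin_no_advection.
      right. field. lra.
Qed.

Theorem theorem2p2 (d1 d2 r p L a1 x1 : R) :
  0 < d1 -> 0 < d2 -> 0 < r -> 0 < p -> 0 < L -> 0 <= x1 -> x1 < L ->
  0 < a1 -> a1 < sqrt (4 * d1 * r) ->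
  L1star d1 r a1 < L -> x1 < Lstar d1 r a1 ->
  (* (i) a2 and h vary *)
  (forall m q, 0 < m -> 0 < q ->
    exists hss : R, exists a2s : R -> R, 0 < hss /\
      strict_incr_on (fun h => hss <= h) a2s /\
      (forall a2 h, 0 <= a2 -> 0 < h -> h < hss -> unstable d1 d2 r m q h a1 a2 x1 L) /\
      (forall a2 h, hss < h -> 0 <= a2 -> a2s h < a2 -> unstable d1 d2 r m q h a1 a2 x1 L) /\
      (forall a2 h, hss < h -> 0 <= a2 -> a2 < a2s h -> lin_stable d1 d2 r m q h a1 a2 x1 L)) /\
  (* (ii) a2 and q vary *)
  (forall m h, 0 < m -> 0 < h ->
    exists qss : R, exists a2b : R -> R, 0 < qss /\
      strict_decr_on (fun q => 0 <= q <= qss) a2b /\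
      (forall a2 q, 0 <= a2 -> qss < q -> unstable d1 d2 r m q h a1 a2 x1 L) /\
      (forall a2 q, 0 < q -> q < qss -> 0 <= a2 -> a2b q < a2 -> unstable d1 d2 r m q h a1 a2 x1 L) /\
      (forall a2 q, 0 < q -> q < qss -> 0 <= a2 -> a2 < a2b q -> lin_stable d1 d2 r m q h a1 a2 x1 L)) /\
  (* (iii) a2 and m vary *)
  (forall q h, 0 < q -> 0 < h ->
    exists mss : R, exists a2h : R -> R, 0 < mss /\
      strict_incr_on (fun m => mss <= m) a2h /\
      (forall a2 m, 0 <= a2 -> 0 < m -> m < mss -> unstable d1 d2 r m q h a1 a2 x1 L) /\
      (forall a2 m, mss < m -> 0 <= a2 -> a2h m < a2 -> unstable d1 d2 r m q h a1 a2 x1 L) /\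
      (forall a2 m, mss < m -> 0 <= a2 -> a2 < a2h m -> lin_stable d1 d2 r m q h a1 a2 x1 L)) /\
  (* (iv) h and m vary *)
  (forall a2 q, 0 <= a2 -> 0 < q ->
    exists hh : R -> R,
      strict_decr_on (fun m => 0 < m) hh /\
      (forall h m, 0 < m -> 0 < h -> h < hh m -> unstable d1 d2 r m q h a1 a2 x1 L) /\
      (forall h m, 0 < m -> 0 < h -> hh m < h -> lin_stable d1 d2 r m q h a1 a2 x1 L)) /\
  (* (v) q and m vary *)
  (forall a2 h, 0 <= a2 -> 0 < h ->
    exists qh : R -> R,
      strict_incr_on (fun m => 0 < m) qh /\
      (forall q m, 0 < m -> 0 < q -> qh m < q -> unstable d1 d2 r m q h a1 a2 x1 L) /\
      (forall q m, 0 < m -> 0 < q -> q < qh m -> lin_stable d1 d2 r m q h a1 a2 x1 L)).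
Proof.
  intros Hd1 Hd2 Hr _ _ Hx0 HxL Ha1 Had HL1 HLs.
  destruct (stability_threshold d1 d2 r L a1 x1 Hd1 Hd2 Hr (conj Hx0 HxL) Ha1 Had HL1 HLs)
    as [F [Fpos [Fstab [Fa [Fq [Fca [Fcq [Fainf [Fqinf Fq0]]]]]]]]].
  assert (Fa' : forall a a' q, 0 <= a -> 0 <= a' -> 0 < q -> F a q < F a' q -> a < a').
  { intros a a' q Ha Ha' Hq H. destruct (Rlt_dec a a') as [|Hn]; [assumption|exfalso].
    destruct (Req_dec a' a) as [->|Hne]; [lra|].
    specialize (Fa a' a q Ha' ltac:(lra) Hq). lra. }
  assert (Fq' : forall a q q', 0 <= a -> 0 < q -> 0 < q' -> F a q < F a q' -> q < q').
  { intros a q q' Ha Hq Hq' H. destruct (Rlt_dec q q') as [|Hn]; [assumption|exfalso].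
    destruct (Req_dec q' q) as [->|Hne]; [lra|].
    specialize (Fq a q' q Ha Hq' ltac:(lra)). lra. }
  assert (Fonto_a : forall q M, 0 < q -> F 0 q <= M -> exists a, 0 <= a /\ F a q = M).
  { intros q M Hq HM.
    assert (HM0 : 0 < M) by (specialize (Fpos 0 q (Rle_refl 0) Hq); lra).
    destruct (Fainf M HM0) as [A [HA HFA]].
    destruct (IVT_half_line (fun a => F a q) 0 A M) as [a [Ha HFa]].
    - lra.
    - intros a Ha e He. apply Fca; assumption.
    - specialize (HFA q Hq). lra.
    - exists a. split; [lra|exact HFa]. }
  assert (Fonto_q : forall a q M, 0 <= a -> 0 < q -> F a q <= M ->
            exists q', q <= q' /\ F a q' = M).
  { intros a q M Ha Hq HM.
    assert (HM0 : 0 < M) by (specialize (Fpos a q Ha Hq); lra).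
    destruct (Fqinf M HM0) as [Q [HQ HFQ]].
    destruct (IVT_half_line (fun q => F a q) q (Rmax q Q) M) as [q' [Hq' HFq']].
    - apply Rmax_l.
    - intros t Ht e He. destruct (Fcq a Ha t ltac:(lra) e He) as [de [Hde H]].
      exists de. split; [exact Hde|]. intros u Hu. apply H. lra.
    - specialize (HFQ a (Rmax q Q) Ha (Rmax_r q Q)). lra.
    - exists q'. split; [lra|exact HFq']. }
  assert (Hadv : forall q k, 0 < q -> 0 < k ->
    exists ks as_, 0 < ks /\ strict_incr_on (fun t => ks <= t) as_ /\
      (forall t, 0 < t -> t < ks -> forall a, 0 <= a -> k * t < F a q) /\
      (forall t, ks < t -> forall a, 0 <= a -> as_ t < a -> k * t < F a q) /\
      (forall t, ks < t -> forall a, 0 <= a -> a < as_ t -> F a q < k * t)).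
  { intros q k Hq Hk. set (ks := F 0 q / k).
    assert (Hks : k * ks = F 0 q) by (unfold ks; field; lra).
    set (as_ := fun t => epsilon (inhabits 0) (fun a => 0 <= a /\ F a q = k * t)).
    assert (Has : forall t, ks <= t -> 0 <= as_ t /\ F (as_ t) q = k * t).
    { intros t Ht. apply epsilon_spec. apply Fonto_a; [exact Hq|]. rewrite <- Hks.
      apply Rmult_le_compat_l; lra. }
    exists ks, as_. split; [apply Rdiv_lt_0_compat; [apply Fpos; lra|exact Hk]|].
    split; [|split; [|split]].
    - intros s t Hs Ht Hst. destruct (Has s Hs) as [As Es]. destruct (Has t Ht) as [At Et].
      apply (Fa' _ _ q As At Hq). rewrite Es, Et. apply Rmult_lt_compat_l; assumption.
    - intros t Ht Htk a Ha. apply Rlt_le_trans with (F 0 q).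
      + rewrite <- Hks. apply Rmult_lt_compat_l; assumption.
      + destruct Ha as [Ha|<-]; [left; apply Fa; lra|right; reflexivity].
    - intros t Ht a Ha Hlt. destruct (Has t ltac:(lra)) as [At Et]. rewrite <- Et.
      apply Fa; assumption.
    - intros t Ht a Ha Hlt. destruct (Has t ltac:(lra)) as [At Et]. rewrite <- Et.
      apply Fa; assumption. }
  split; [|split; [|split; [|split]]].
  - intros m q Hm Hq. destruct (Hadv q m Hq Hm) as [hss [a2s [H0 [H1 [H2 [H3 H4]]]]]].
    exists hss, a2s. split; [exact H0|]. split; [exact H1|]. split; [|split].
    + intros a2 h Ha Hh Hlt. apply Fstab; auto.
    + intros a2 h Hlt Ha Hlt'. apply Fstab; auto. lra.
    + intros a2 h Hlt Ha Hlt'. apply Fstab; auto. lra.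
  - intros m h Hm Hh. set (M := m * h).
    assert (HM : 0 < M) by (apply Rmult_lt_0_compat; assumption).
    destruct (Fq0 M HM) as [q1 [Hq1 HFq1]].
    destruct (Fonto_q 0 q1 M (Rle_refl 0) Hq1 ltac:(lra)) as [qss [Hqss HFqss]].
    destruct (Fainf M HM) as [A [HA HFA]].
    set (a2b := fun q => if Rle_dec q 0 then A else
                  epsilon (inhabits 0) (fun a => 0 <= a /\ F a q = M)).
    assert (Hab : forall q, 0 < q <= qss -> 0 <= a2b q /\ F (a2b q) q = M).
    { intros q Hq. unfold a2b. destruct (Rle_dec q 0); [lra|]. apply epsilon_spec.
      apply Fonto_a; [lra|]. rewrite <- HFqss. destruct (proj2 Hq) as [Hlt|Heq].
      - left. apply Fq; lra.
      - rewrite Heq. lra. }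
    exists qss, a2b. split; [lra|]. split; [|split; [|split]].
    + intros q q' Hq Hq' Hlt. destruct (Hab q' ltac:(lra)) as [A' E'].
      destruct (proj1 Hq) as [Hq0|Hq0].
      * destruct (Hab q ltac:(lra)) as [A0 E0]. apply (Fa' _ _ q A' A0 Hq0).
        rewrite E0, <- E'. apply Fq; lra.
      * unfold a2b at 2. destruct (Rle_dec q 0); [|lra].
        apply (Fa' _ _ q'); try lra. rewrite E'. apply HFA. lra.
    + intros a2 q Ha Hlt. apply Fstab; auto; [lra|]. fold M. rewrite <- HFqss.
      apply Rlt_le_trans with (F 0 q); [apply Fq; lra|].
      destruct Ha as [Ha|<-]; [left; apply Fa; lra|right; reflexivity].
    + intros a2 q Hq Hlt Ha Hlt'. apply Fstab; auto. fold M.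
      destruct (Hab q ltac:(lra)) as [A0 E0]. rewrite <- E0. apply Fa; assumption.
    + intros a2 q Hq Hlt Ha Hlt'. apply Fstab; auto. fold M.
      destruct (Hab q ltac:(lra)) as [A0 E0]. rewrite <- E0. apply Fa; assumption.
  - intros q h Hq Hh. destruct (Hadv q h Hq Hh) as [mss [a2h [H0 [H1 [H2 [H3 H4]]]]]].
    exists mss, a2h. split; [exact H0|]. split; [exact H1|]. split; [|split].
    + intros a2 m Ha Hm Hlt. apply Fstab; auto. rewrite Rmult_comm. auto.
    + intros a2 m Hlt Ha Hlt'. apply Fstab; auto; [lra|]. rewrite Rmult_comm. auto.
    + intros a2 m Hlt Ha Hlt'. apply Fstab; auto; [lra|]. rewrite Rmult_comm. auto.
  - intros a2 q Ha Hq. specialize (Fpos a2 q Ha Hq).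
    assert (Hmf : forall m, 0 < m -> m * (F a2 q / m) = F a2 q) by (intros; field; lra).
    exists (fun m => F a2 q / m). split; [|split].
    + intros m m' Hm Hm' Hlt. apply Rmult_lt_compat_l; [exact Fpos|].
      apply Rinv_lt_contravar; [apply Rmult_lt_0_compat|]; assumption.
    + intros h m Hm Hh Hlt. apply Fstab; auto. rewrite <- (Hmf m Hm).
      apply Rmult_lt_compat_l; assumption.
    + intros h m Hm Hh Hlt. apply Fstab; auto. rewrite <- (Hmf m Hm).
      apply Rmult_lt_compat_l; assumption.
  - intros a2 h Ha Hh.
    (* When every [q > 0] is unstable the threshold is given a negative value. *)
    set (qh := fun m => if excluded_middle_informative (exists q, 0 < q /\ F a2 q = m * h)
                 then epsilon (inhabits 0) (fun q => 0 < q /\ F a2 q = m * h) else - / m).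
    assert (Hqh : forall m, 0 < m ->
              (0 < qh m /\ F a2 (qh m) = m * h) \/
              (qh m = - / m /\ forall q, 0 < q -> m * h < F a2 q)).
    { intros m Hm. unfold qh.
      destruct (excluded_middle_informative (exists q, 0 < q /\ F a2 q = m * h)) as [Hex|Hex].
      - left. apply epsilon_spec. exact Hex.
      - right. split; [reflexivity|]. intros q Hq.
        destruct (Rlt_dec (m * h) (F a2 q)) as [|Hn]; [assumption|exfalso]. apply Hex.
        destruct (Fonto_q a2 q (m * h) Ha Hq ltac:(lra)) as [q' [Hq' E]].
        exists q'. split; [lra|exact E]. }
    exists qh. split; [|split].
    + intros m m' Hm Hm' Hlt.
      assert (Hmh : m * h < m' * h) by (apply Rmult_lt_compat_r; assumption).
      pose proof (Rinv_0_lt_compat m Hm) as Hi. pose proof (Rinv_0_lt_compat m' Hm') as Hi'.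
      destruct (Hqh m Hm) as [[Hq E]|[E Hall]]; destruct (Hqh m' Hm') as [[Hq' E']|[E' Hall']].
      * apply (Fq' a2); try assumption. lra.
      * specialize (Hall' (qh m) Hq). lra.
      * lra.
      * rewrite E, E'. apply Ropp_lt_contravar, Rinv_lt_contravar; [|exact Hlt].
        apply Rmult_lt_0_compat; assumption.
    + intros q m Hm Hq Hlt. apply Fstab; auto. destruct (Hqh m Hm) as [[Hq' E]|[_ Hall]].
      * rewrite <- E. apply Fq; assumption.
      * apply Hall, Hq.
    + intros q m Hm Hq Hlt. apply Fstab; auto. destruct (Hqh m Hm) as [[Hq' E]|[E Hall]].
      * rewrite <- E. apply Fq; assumption.
      * pose proof (Rinv_0_lt_compat m Hm). lra.
Qed.
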